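(* Suppose that $f^{(s)}+k^{(s)}\in L^1(0,T;X)$ (time derivatives of order $s$). Then the $s$-stage method $$u_{n+1}=\mathrm{e}^{\tau_nA}\bigl(u_n-z(t_n)\bigr)+z(t_{n+1})+\tau_n\sum_{i=1}^s b_i(\tau_nA)\bigl(f(t_n+c_i\tau_n)+k(t_n+c_i\tau_n)\bigr),\qquad 0\le n\le N-1,$$ started from the initial value $u_0$ and applied to the problem $\partial_tu=Du+f(t)$, $Bu=b(t)$, $u(0)=u_0$ on $[0,T]$, converges with order $s$. More precisely, the error satisfies $$\|u(t_n)-u_n\|\le C\sum_{j=0}^{n-1}\tau_j^{s}\int_{t_j}^{t_{j+1}}\bigl\|f^{(s)}(\tau)+k^{(s)}(\tau)\bigr\|\,d\tau$$ for all $n$ with $0\le t_n\le T$. The constant $C$ depends on $T$, but is independent of $n$ and of the step size sequence $\{\tau_n\}_{n=0}^{N-1}$.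
   Context: **Problem.** $(X,\|\cdot\|)$ is a Banach space of functions on a domain $\Omega\subset\mathbb{R}^d$, $D$ is a strongly elliptic linear differential operator with smooth coefficients, $B$ is a linear boundary operator (Dirichlet, Neumann or mixed boundary conditions), and $u=u(t)$ (dependence on $x\in\Omega$ suppressed) denotes the exact solution on $[0,T]$ of $$\partial_tu=Du+f(t),\qquad Bu=b(t),\qquad u(0)=u_0 .$$ **Correction.** $z=z(t,x)$ is a smooth function with $Bz=b$, and $k:=Dz-\partial_tz$. The function $w=u-z$ satisfies $Bw=0$. **Operator.** $A$ is the restriction of $D$ to functions satisfying $Bu=0$, with domain $D(A)\subset X$. It is assumed that $A$ is sectorial: $A$ is densely defined and closed on $X$ and there are $M\ge1$, $a\in\mathbb{R}$, $\pi/2<\theta<\pi$ with $\|(\lambda I-A)^{-1}\|\le M/|\lambda-a|$ for all $\lambda\in\mathbb{C}$ with $\lambda\ne a$, $|\arg(\lambda-a)|\le\theta$. Thus $A$ generates an analytic semigroup $\{\mathrm{e}^{tA}\}_{t\ge0}$, and $w$ is the solution of the abstract problem $w'(t)=Aw(t)+f(t)+k(t)$, $w(0)=u_0-z(0)$, i.e. $w(t)=\mathrm{e}^{tA}w(0)+\int_0^t\mathrm{e}^{(t-\xi)A}(f(\xi)+k(\xi))\,d\xi$. **$\varphi$-functions.** $\varphi_0(\zeta)=\mathrm{e}^\zeta$, $\varphi_j(\zeta)=\bigl(\varphi_{j-1}(\zeta)-\frac1{(j-1)!}\bigr)/\zeta$ for $j\ge1$; for operators, $\varphi_j(\tau A)=\tau^{-j}\int_0^\tau\mathrm{e}^{(\tau-\xi)A}\frac{\xi^{j-1}}{(j-1)!}\,d\xi$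 for $j\ge1$, $\tau>0$. **Quadrature rule.** The nodes $c_1,\dots,c_s\in[0,1]$ are pairwise distinct and the weights $b_1(\tau A),\dots,b_s(\tau A)$ are the linear combinations of $\varphi_1(\tau A),\dots,\varphi_s(\tau A)$ uniquely determined by the order conditions $$\frac1{(j-1)!}\sum_{i=1}^sb_i(\tau A)c_i^{j-1}=\varphi_j(\tau A),\qquad j=1,\dots,s.$$ **Grid.** $\tau_n>0$, $t_0=0$, $t_{n+1}=t_n+\tau_n$ for $n=0,\dots,N-1$, $t_N=T$. *)

(* Defs.v *)
From HB Require Import structures.
From mathcomp Require Import all_boot all_order all_algebra.
From mathcomp Require Import all_classical all_reals all_analysis.
From mathcomp Require Export complex.

Set Implicit Arguments.
Unset Strict Implicit.
Unset Printing Implicit Defensive.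

Import Order.TTheory GRing.Theory Num.Theory.
Import numFieldNormedType.Exports.

Local Open Scope classical_set_scope.
Local Open Scope ring_scope.
Local Open Scope complex_scope.

(* Exact functions, not classes.  A space of classes such as L^p is covered by
   fixing a linear choice of representatives which picks the continuous
   representative of every class that has one. *)
Definition funs (R : realType) (d : nat) (Om : set 'rV[R]_d)
  : lmodType R[i] := {x : 'rV[R]_d | Om x} -> R[i]^o.

Definition restr (R : realType) (d : nat) (Om : set 'rV[R]_d)
  (v : 'rV[R]_d -> R[i]) : funs Om := fun x => v (sval x).
Arguments restr {R d} Om v.

Definition boundary (R : realType) (d : nat) (Om : set 'rV[R]_d) :=
  closure Om `\` Om.

Definition bdata (R : realType) (d m : nat) (Om : set 'rV[R]_d)
  : lmodType R[i] := {x : 'rV[R]_d | boundary Om x} -> 'rV[R[i]]_m.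

Definition is_domain (R : realType) (d : nat) (Om : set 'rV[R]_d) :=
  [/\ (0 < d)%N, open Om, connected Om & Om !=set0].

Fixpoint Ck_on (R : realType) (V : normedModType R) (k : nat) (U : set V)
    (F : V -> R) : Prop :=
  (forall x, U x -> {for x, continuous F}) /\
  if k is k'.+1 then
    forall v, (forall x, U x -> derivable F x v) /\
              Ck_on k' U (fun x => 'D_v F x)
  else True.

(* For closed K: smooth up to the boundary, i.e. C^oo near K. *)
Definition smooth_on (R : realType) (V : normedModType R) (K : set V)
    (F : V -> R[i]) : Prop :=
  exists U : set V, [/\ open U, K `<=` U &
    forall k, Ck_on k U (fun x => complex.Re (F x)) /\
              Ck_on k U (fun x => complex.Im (F x))].

Definition pderiv (R : realType) (d : nat) (i : 'I_d) (v : 'rV[R]_d -> R[i])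
    (x : 'rV[R]_d) : R[i] :=
  ('D_(delta_mx 0 i) (fun y => complex.Re (v y)) x) +i*
  ('D_(delta_mx 0 i) (fun y => complex.Im (v y)) x).

Definition mpderiv (R : realType) (d r : nat) (al : {ffun 'I_d -> 'I_r.+1})
    (v : 'rV[R]_d -> R[i]) : 'rV[R]_d -> R[i] :=
  foldr (fun i w => iter (al i) (pderiv i) w) v (enum 'I_d).

Definition tderiv (R : realType) (d : nat) (z : R -> 'rV[R]_d -> R[i])
    (t : R) (x : 'rV[R]_d) : R[i] :=
  (derive1 (fun r => complex.Re (z r x)) t) +i*
  (derive1 (fun r => complex.Im (z r x)) t).

Definition coeffs (R : realType) (d r : nat) :=
  {ffun 'I_d -> 'I_r.+1} -> 'rV[R]_d -> R[i].

Definition diffop (R : realType) (d r : nat) (a : coeffs R d r)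
    (v : 'rV[R]_d -> R[i]) (x : 'rV[R]_d) : R[i] :=
  \sum_(al : {ffun 'I_d -> 'I_r.+1} | (\sum_i (al i : nat) <= r)%N)
    a al x * mpderiv al v x.

(* Order 2m, with the sign for which the Laplacian (m = 1) is elliptic. *)
Definition strongly_elliptic (R : realType) (d m : nat) (Om : set 'rV[R]_d)
    (a : coeffs R d (2 * m)) : Prop :=
  exists2 kappa : R, 0 < kappa &
    forall x (xi : 'rV[R]_d), closure Om x ->
      kappa * (\sum_i xi 0 i ^+ 2) ^+ m <=
      (-1) ^+ m.+1 * complex.Re
        (\sum_(al : {ffun 'I_d -> 'I_(2 * m).+1}
               | (\sum_i (al i : nat) == 2 * m)%N)
            a al x * (\prod_i xi 0 i ^+ al i)%:C).

(* A linear operator with a domain; [pl_fun] is meaningful on [pl_dom] only. *)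
Record plin (R : realType) (U V : lmodType R[i]) := PLin {
  pl_dom : set U;
  pl_fun :> U -> V;
  pl_dom0 : pl_dom 0;
  pl_domP : forall a x y, pl_dom x -> pl_dom y -> pl_dom (a *: x + y);
  pl_linP : forall a x y, pl_dom x -> pl_dom y ->
    pl_fun (a *: x + y) = a *: pl_fun x + pl_fun y }.

(* D is the differential expression on smooth functions; on the remaining
   functions of its domain it is any linear extension (weak derivatives). *)
Definition elliptic_operator (R : realType) (d m : nat) (Om : set 'rV[R]_d)
    (D : plin (funs Om) (funs Om)) : Prop :=
  exists a : coeffs R d (2 * m),
    [/\ (0 < m)%N,
        forall al, smooth_on (closure Om) (a al),
        strongly_elliptic Om a &
        forall v, smooth_on (closure Om) v ->
          pl_dom D (restr Om v) /\
          D (restr Om v) = restr Om (diffop a v)].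

(* On smooth functions B is a system of m boundary differential operators with
   arbitrary coefficients, which covers Dirichlet (v), Neumann (normal or
   conormal derivative) and mixed conditions (coefficients that switch between
   the two along the boundary); elsewhere it is any linear extension (traces). *)
Definition boundary_operator (R : realType) (d m : nat) (Om : set 'rV[R]_d)
    (B : plin (funs Om) (bdata m Om)) : Prop :=
  exists b : 'I_m -> coeffs R d (2 * m).-1,
    forall v, smooth_on (closure Om) v ->
      pl_dom B (restr Om v) /\
      B (restr Om v) = (fun x => \row_j diffop (b j) v (sval x)).

(* In a normed space over R[i] the norm is an element of R[i]. *)
Definition nrm (R : realType) (X : normedModType R[i]) (x : X) : R :=
  complex.Re `|x|.

Definition restricted_operator (R : realType) (d m : nat) (Om : set 'rV[R]_d)
    (X : completeNormedModType R[i]) (incl : {linear X -> funs Om})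
    (D : plin (funs Om) (funs Om)) (B : plin (funs Om) (bdata m Om))
    (A : plin X X) : Prop :=
  forall x y : X, (pl_dom A x /\ A x = y) <->
    [/\ pl_dom D (incl x), pl_dom B (incl x), B (incl x) = 0 &
        D (incl x) = incl y].

Definition sectorial (R : realType) (X : completeNormedModType R[i])
    (A : plin X X) : Prop :=
  [/\ closure (pl_dom A) = setT,
      closed [set p : X * X | pl_dom A p.1 /\ A p.1 = p.2] &
      exists M a theta : R,
        [/\ 1 <= M, pi / 2 < theta, theta < pi &
        (* lambda = a + r e^(i omega), so r = |lambda - a| *)
        forall r omega : R, 0 < r -> `|omega| <= theta ->
          let lambda := (a + r * cos omega) +i* (r * sin omega) in
          exists Res : X -> X,
            [/\ forall y, pl_dom A (Res y) /\
                          lambda *: Res y - A (Res y) = y,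
                forall x, pl_dom A x -> Res (lambda *: x - A x) = x &
                forall y, nrm (Res y) <= M / r * nrm y]]].

(* S t = e^(tA): the strongly continuous semigroup with generator A, which
   determines it uniquely. *)
Definition semigroup_of (R : realType) (X : completeNormedModType R[i])
    (A : plin X X) (S : R -> X -> X) : Prop :=
  [/\ forall x, S 0 x = x,
      forall t r x, 0 <= t -> 0 <= r -> S (t + r) x = S t (S r x),
      forall t, 0 <= t -> linear (S t) /\ continuous (S t),
      forall x, S t x @[t --> 0^'+] --> x &
      forall x y, (pl_dom A x /\ A x = y) <->
        ((h^-1)%:C *: (S h x - x) @[h --> 0^'+] --> y)].

Definition simple_fun (R : realType) (X : completeNormedModType R[i])
    (p : seq (set R * X)) (t : R) : X :=
  \sum_(q <- p) (\1_(q.1) t)%:C *: q.2.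

Definition simple_int (R : realType) (X : completeNormedModType R[i])
    (J : set R) (p : seq (set R * X)) : X :=
  \sum_(q <- p) (fine (lebesgue_measure (J `&` q.1)))%:C *: q.2.

(* Simple functions converge at every point of the interval: no loss, since each
   class modulo a.e. equality has a representative with this property. *)
Definition is_bochner (R : realType) (X : completeNormedModType R[i])
    (a b : R) (F : R -> X) (v : X) : Prop :=
  exists p : nat -> seq (set R * X),
    [/\ forall n q, q \in p n -> measurable q.1,
        forall t, a <= t <= b -> simple_fun (p n) t @[n --> \oo] --> F t,
        (\int[lebesgue_measure]_(t in `[a, b])
           (nrm (F t - simple_fun (p n) t))%:E)%E @[n --> \oo] --> 0%E &
        simple_int `[a, b] (p n) @[n --> \oo] --> v].

Definition bochner_integrable (R : realType) (X : completeNormedModType R[i])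
    (a b : R) (F : R -> X) : Prop := exists v, is_bochner a b F v.

Definition bochner (R : realType) (X : completeNormedModType R[i])
    (a b : R) (F : R -> X) : X := xget 0 (is_bochner a b F).

(* h = g^(s) lies in L^1(0,T;X): each derivative is the integrable function of
   which the preceding one is a primitive.  This fixes the continuous
   representative of g, which the quadrature formula evaluates pointwise. *)
Fixpoint L1_deriv (R : realType) (X : completeNormedModType R[i])
    (s : nat) (T : R) (g h : R -> X) : Prop :=
  if s is s'.+1 then
    exists g1 : R -> X,
      [/\ bochner_integrable 0 T g1,
          forall t, 0 <= t <= T -> g t = g 0 + bochner 0 t g1 &
          L1_deriv s' T g1 h]
  else forall t, 0 <= t <= T -> g t = h t.

(* [phi S j tau] is phi_(j+1)(tau A). *)
Definition phi (R : realType) (X : completeNormedModType R[i])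
    (S : R -> X -> X) (j : nat) (tau : R) (x : X) : X :=
  (tau ^- j.+1)%:C *:
    bochner 0 tau (fun xi => (xi ^+ j / j`!%:R)%:C *: S (tau - xi) x).

Definition quadrature_weights (R : realType) (X : completeNormedModType R[i])
    (S : R -> X -> X) (s : nat) (c : 'I_s -> R) (b : 'I_s -> R -> X -> X) :=
  (exists beta : 'M[R[i]]_s, forall i tau x, 0 < tau ->
     b i tau x = \sum_(j < s) beta i j *: phi S j tau x) /\
  (forall (j : 'I_s) tau x, 0 < tau ->
     (j`!%:R^-1)%:C *: (\sum_(i < s) (c i ^+ j)%:C *: b i tau x) =
     phi S j tau x).

Definition correction_rhs (R : realType) (d : nat) (Om : set 'rV[R]_d)
    (D : plin (funs Om) (funs Om)) (z : R -> 'rV[R]_d -> R[i]) (t : R)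
    : funs Om :=
  D (restr Om (z t)) - restr Om (tderiv z t).

Definition correction (R : realType) (d m : nat) (Om : set 'rV[R]_d)
    (B : plin (funs Om) (bdata m Om)) (T : R) (b : R -> bdata m Om)
    (z : R -> 'rV[R]_d -> R[i]) : Prop :=
  smooth_on [set p : R * 'rV[R]_d | 0 <= p.1 <= T /\ closure Om p.2]
            (fun p => z p.1 p.2) /\
  forall t, 0 <= t <= T -> B (restr Om (z t)) = b t.

(* w = u - z takes its values in X and is given by the variation-of-constants
   formula with right-hand side g = f + k. *)
Definition exact_solution (R : realType) (d : nat) (Om : set 'rV[R]_d)
    (X : completeNormedModType R[i]) (incl : {linear X -> funs Om})
    (S : R -> X -> X) (T : R) (z : R -> 'rV[R]_d -> R[i]) (g : R -> X)
    (u0 : funs Om) (u : R -> funs Om) : Prop :=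
  u 0 = u0 /\
  exists w : R -> X, forall t, 0 <= t <= T ->
    incl (w t) = u t - restr Om (z t) /\
    w t = S t (w 0) + bochner 0 t (fun xi => S (t - xi) (g xi)).

Definition node (R : realType) (tau : nat -> R) (n : nat) : R :=
  \sum_(j < n) tau j.

Definition grid (R : realType) (T : R) (N : nat) (tau : nat -> R) : Prop :=
  (forall j, (j < N)%N -> 0 < tau j) /\ node tau N = T.

(* The iterates are functions on Om; e^(tau A) acts on u_n - z(t_n), which is
   the element v of X. *)
Definition method (R : realType) (d : nat) (Om : set 'rV[R]_d)
    (X : completeNormedModType R[i]) (incl : {linear X -> funs Om})
    (S : R -> X -> X) (s : nat) (c : 'I_s -> R) (b : 'I_s -> R -> X -> X)
    (z : R -> 'rV[R]_d -> R[i]) (g : R -> X) (u0 : funs Om)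
    (N : nat) (tau : nat -> R) (U : nat -> funs Om) : Prop :=
  U 0%N = u0 /\
  forall n, (n < N)%N ->
    exists2 v : X, incl v = U n - restr Om (z (node tau n)) &
      U n.+1 = incl (S (tau n) v) + restr Om (z (node tau n.+1))
        + incl ((tau n)%:C *:
            \sum_(i < s) b i (tau n) (g (node tau n + c i * tau n))).

Definition norm_le (R : realType) (d : nat) (Om : set 'rV[R]_d)
    (X : completeNormedModType R[i]) (incl : {linear X -> funs Om})
    (y : funs Om) (r : R) : Prop :=
  exists2 e : X, incl e = y & nrm e <= r.

(* Main.v *)
Require Import Defs.
From HB Require Import structures.
From mathcomp Require Import all_boot all_order all_algebra.
From mathcomp Require Import all_classical all_reals all_analysis.
From mathcomp Require Import measurable_realfun ring.

Set Implicit Arguments.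
Unset Strict Implicit.
Unset Printing Implicit Defensive.

Import Order.TTheory GRing.Theory Num.Theory.
Import numFieldNormedType.Exports.

Local Open Scope classical_set_scope.
Local Open Scope ring_scope.
Local Open Scope complex_scope.

(** The correction turns the problem into one for w = u - z, which is a mild
    solution of w' = Aw + g with g = f + k.  Over one step of length tau from
    t, w is multiplied by e^(tau A) and receives the integral over [0, tau] of
    e^((tau - xi)A) g(t + xi) ([mild_solution_step]); the numerical values,
    corrected in the same way, receive the quadrature sum instead.  The order
    conditions say that the two agree when xi |-> g(t + xi) is a polynomial of
    degree less than s ([quadrature_exact]).  Since g^(s) is integrable, g
    differs from such a polynomial by at most tau^(s-1) times the integral of
    |g^(s)| over the step ([taylor_remainder]); the semigroup and the weights
    are bounded uniformly in tau <= T, so the defect of one step is at most a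
    constant times tau^s times that integral ([quadrature_error]).

    The errors satisfy e_(n+1) = e^(tau_n A) e_n + delta_n with e_0 = 0, so
    e_n is the sum of the defects delta_j propagated by e^((t_n - t_(j+1))A).
    As the semigroup is bounded on [0, T], the defects simply add up, whatever
    the step sizes are.

    Two pieces of analysis support this.  The vector-valued integral is
    developed from simple functions; the basic estimate, that the norm of an
    integral is at most the integral of the norm, yields uniqueness and, by
    completeness, existence.  For continuous integrands it is the limit of
    Riemann sums, from which its shifts and the integrals of monomials are
    read off.  The bound of the semigroup on [0, T] comes from strong
    continuity at 0 by the uniform boundedness principle. *)

(** * The norm as a real number *)

Lemma gt0_complexE (R : realType) (e : R[i]) : 0 < e ->
  e = (complex.Re e)%:C /\ 0 < complex.Re e.
Proof. by case: e => a b; rewrite ltcE /= => /andP[/eqP->]. Qed.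

Section Norm.
Variables (R : realType) (X : normedModType R[i]).
Implicit Types (x y : X).

Lemma nrmE x : `|x| = (nrm x)%:C.
Proof.
rewrite /nrm; have : 0 <= `|x| by [].
by case: (`|x|) => a b; rewrite lecE /= => /andP[/eqP-> _].
Qed.

Lemma nrm_ge0 x : 0 <= nrm x.
Proof. by rewrite -ler0c -nrmE. Qed.

Lemma nrm0 : nrm (0 : X) = 0.
Proof. by rewrite /nrm normr0. Qed.

Lemma nrm_eq0 x : nrm x = 0 -> x = 0.
Proof. by move=> x0; apply/eqP; rewrite -normr_eq0 nrmE x0. Qed.

Lemma nrmN x : nrm (- x) = nrm x.
Proof. by rewrite /nrm normrN. Qed.

Lemma nrm_distC x y : nrm (x - y) = nrm (y - x).
Proof. by rewrite -nrmN opprB. Qed.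

Lemma nrmD x y : nrm (x + y) <= nrm x + nrm y.
Proof. by rewrite -lecR rmorphD /= -!nrmE ler_normD. Qed.

Lemma nrmB x y : nrm (x - y) <= nrm x + nrm y.
Proof. by rewrite -(nrmN y) nrmD. Qed.

Lemma nrm_distD y x z : nrm (x - z) <= nrm (x - y) + nrm (y - z).
Proof. by apply: le_trans (nrmD _ _); rewrite addrA subrK. Qed.

Lemma nrmZ (a : R) x : nrm (a%:C *: x) = `|a| * nrm x.
Proof.
apply: (@complexI R); rewrite -nrmE normrZ nrmE rmorphM /=; congr (_ * _).
by rewrite normc_def /= expr0n addr0 sqrtr_sqr.
Qed.

Lemma nrmZc (a : R[i]) x : nrm (a *: x) = complex.Re `|a| * nrm x.
Proof.
apply: (@complexI R); rewrite -nrmE normrZ nrmE rmorphM /=; congr (_ * _).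
Qed.

Lemma nrm_sum (I : Type) (r : seq I) (P : pred I) (F : I -> X) :
  nrm (\sum_(i <- r | P i) F i) <= \sum_(i <- r | P i) nrm (F i).
Proof.
elim/big_ind2: _ => [|x1 r1 x2 r2 h1 h2|//]; first by rewrite nrm0.
exact: le_trans (nrmD _ _) (lerD h1 h2).
Qed.

Lemma ler_dist_nrm x y : `|nrm x - nrm y| <= nrm (x - y).
Proof.
rewrite ler_norml; apply/andP; split.
  by rewrite lerNl opprB lerBlDr nrm_distC (le_trans _ (nrmD _ _))// subrK.
by rewrite lerBlDr (le_trans _ (nrmD _ _))// subrK.
Qed.

Lemma cvg_nrmP (T : Type) (F : set_system T) (FF : Filter F) (f : T -> X) x :
  f t @[t --> F] --> x <-> nrm (f t - x) @[t --> F] --> (0 : R).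
Proof.
split=> [/cvgrPdist_lt fx|/cvgrPdist_lt fx].
- apply/cvgrPdist_lt => e e0; have /fx : 0 < e%:C by rewrite ltcR.
  apply: filterS => t.
  by rewrite nrmE ltcR sub0r normrN ger0_norm ?nrm_ge0// nrm_distC.
- apply/cvgrPdist_lt => e /gt0_complexE[eE /fx]; apply: filterS => t.
  by rewrite eE nrmE ltcR sub0r normrN ger0_norm ?nrm_ge0// nrm_distC.
Qed.

Lemma cvg_nrm (T : Type) (F : set_system T) (FF : Filter F) (f : T -> X) x :
  f t @[t --> F] --> x -> nrm (f t) @[t --> F] --> nrm x.
Proof.
move=> /cvg_nrmP /cvgrPdist_lt fx; apply/cvgrPdist_lt => e e0.
apply: filterS (fx _ e0) => t; rewrite sub0r normrN ger0_norm ?nrm_ge0//.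
by apply: le_lt_trans; rewrite distrC ler_dist_nrm.
Qed.

End Norm.

Lemma nrm_cauchy_cvg (R : realType) (X : completeNormedModType R[i])
    (u : nat -> X) :
  (forall e : R, 0 < e -> exists N, forall n m, (N <= n)%N -> (N <= m)%N ->
     nrm (u n - u m) < e) ->
  exists x : X, u n @[n --> \oo] --> x.
Proof.
move=> cu; suff /cvg_ex[l ul] : cvgn u by exists l.
apply/cauchy_cvgP/cauchyP => e /gt0_complexE[eE e0].
have [N cN] := cu _ e0; exists (u N); exists N => // n /= Nn.
by rewrite -ball_normE /ball_ /= eE nrmE ltcR cN.
Qed.

(** * Integrals of simple functions *)

Section SimpleFunctions.
Variables (R : realType) (X : completeNormedModType R[i]).
Implicit Types (p q : seq (set R * X)) (J D : set R) (x y : X).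
Local Notation mu := (@lebesgue_measure R).

Definition simple_measurable p := forall e, e \in p -> measurable e.1.

Definition simple_map (Y : completeNormedModType R[i]) (L : X -> Y) p :=
  [seq (e.1, L e.2) | e <- p].

Lemma simple_measurable_cons e p :
  simple_measurable (e :: p) -> measurable e.1 /\ simple_measurable p.
Proof.
move=> mp; split; first by apply: mp; rewrite mem_head.
by move=> e' e'p; apply: mp; rewrite inE e'p orbT.
Qed.

Lemma simple_measurable_cat p q :
  simple_measurable p -> simple_measurable q -> simple_measurable (p ++ q).
Proof. by move=> mp mq e; rewrite mem_cat => /orP[/mp|/mq]. Qed.

Lemma simple_fun_cat p q t :
  simple_fun (p ++ q) t = simple_fun p t + simple_fun q t.
Proof. by rewrite /simple_fun big_cat. Qed.

Lemma simple_int_cat J p q :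
  simple_int J (p ++ q) = simple_int J p + simple_int J q.
Proof. by rewrite /simple_int big_cat. Qed.

Lemma simple_fun_cons e p t :
  simple_fun (e :: p) t = (\1_(e.1) t)%:C *: e.2 + simple_fun p t.
Proof. by rewrite /simple_fun big_cons. Qed.

Lemma simple_int_cons J e p :
  simple_int J (e :: p) = (fine (mu (J `&` e.1)))%:C *: e.2 + simple_int J p.
Proof. by rewrite /simple_int big_cons. Qed.

(** The sets of a simple function may overlap, so its value on the first set
    is a shift of the remaining sum; this is why the shift [x] is carried
    along the induction. *)
Lemma measurable_nrm_simple D p x : measurable D -> simple_measurable p ->
  measurable_fun D (fun t => nrm (x + simple_fun p t)).
Proof.
move=> mD; elim: p x => [|e p IH] x mp.
  under eq_fun do rewrite /simple_fun big_nil.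
  exact: measurable_cst.
have [me {}mp] := simple_measurable_cons mp.
rewrite [X in measurable_fun _ X](_ : _ = fun t =>
  \1_(e.1) t * nrm (x + e.2 + simple_fun p t) +
  (1 - \1_(e.1) t) * nrm (x + simple_fun p t)); last first.
  apply/funext => t; rewrite simple_fun_cons indicE.
  case: (t \in e.1) => /=; last by rewrite scale0r add0r mul0r add0r subr0 mul1r.
  by rewrite scale1r addrA mul1r subrr mul0r addr0.
have mi : measurable_fun D (\1_(e.1) : R -> R) by exact: measurable_indic.
apply: measurable_funD; apply: measurable_funM => //; try exact: IH.
by apply: measurable_funB => //; exact: measurable_cst.
Qed.

Lemma lebesgue_split J (E : set R) :
  measurable J -> (mu J < +oo)%E -> measurable E ->
  fine (mu J) = fine (mu (J `&` E)) + fine (mu (J `\` E)).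
Proof.
move=> mJ Joo mE; rewrite -fineD.
- by rewrite addeC; congr fine; apply: measureDI.
- rewrite ge0_fin_numE//; apply: le_lt_trans Joo.
  by apply: le_measure; rewrite ?inE//; exact: measurableI.
- rewrite ge0_fin_numE//; apply: le_lt_trans Joo.
  by apply: le_measure; rewrite ?inE//; exact: measurableD.
Qed.

Lemma simple_int_split J E p : measurable J -> (mu J < +oo)%E -> measurable E ->
  simple_measurable p ->
  simple_int J p = simple_int (J `&` E) p + simple_int (J `\` E) p.
Proof.
move=> mJ Joo mE; elim: p => [|e p IH] mp.
  by rewrite /simple_int !big_nil addr0.
have [me {}mp] := simple_measurable_cons mp.
rewrite !simple_int_cons IH// addrACA; congr (_ + _).
rewrite -scalerDl -rmorphD /=; congr (_%:C *: _).
rewrite (@lebesgue_split (J `&` e.1) E)//; last 2 first.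
- exact: measurableI.
- apply: le_lt_trans Joo.
  by apply: le_measure; rewrite ?inE//; exact: measurableI.
- by congr (fine (mu _) + fine (mu _)); apply/seteqP; split => t /=; tauto.
Qed.

(** The sets of a simple function may overlap.  Instead of refining them, the
    induction cuts the domain [J] along the first set: there its vector is
    absorbed in the constant [x], elsewhere it vanishes, and both pieces fall
    under the induction hypothesis. *)
Lemma nrm_simple_int_shift J p x :
  measurable J -> (mu J < +oo)%E -> simple_measurable p ->
  ((nrm ((fine (mu J))%:C *: x + simple_int J p))%:E <=
   \int[mu]_(t in J) (nrm (x + simple_fun p t))%:E)%E.
Proof.
elim: p J x => [|e p IH] J x mJ Joo mp.
  rewrite /simple_int big_nil addr0 nrmZ ger0_norm ?fine_ge0//.
  under eq_integral do rewrite /simple_fun big_nil addr0.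
  by rewrite integral_cst// muleC EFinM fineK// ge0_fin_numE.
have me2 := measurable_nrm_simple x mJ mp.
have mep := mp; have [me {}mp] := simple_measurable_cons mp.
have mJe : measurable (J `&` e.1) by exact: measurableI.
have mJDe : measurable (J `\` e.1) by exact: measurableD.
have Jeoo : (mu (J `&` e.1) < +oo)%E.
  by apply: le_lt_trans Joo; apply: le_measure; rewrite ?inE.
have JDeoo : (mu (J `\` e.1) < +oo)%E.
  by apply: le_lt_trans Joo; apply: le_measure; rewrite ?inE.
have JE : J = (J `&` e.1) `|` (J `\` e.1) by rewrite setUIDK.
rewrite [X in (_ <= \int[mu]_(t in X) _)%E]JE ge0_integral_setU//=; last 3 first.
- rewrite -JE; exact/measurable_EFinP.
- by move=> t _; rewrite lee_fin nrm_ge0.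
- by apply/disj_setPS => t /= [[_ ?] [_ ?]].
have -> : (fine (mu J))%:C *: x + simple_int J (e :: p) =
   ((fine (mu (J `&` e.1)))%:C *: (x + e.2) + simple_int (J `&` e.1) p) +
   ((fine (mu (J `\` e.1)))%:C *: x + simple_int (J `\` e.1) p).
  rewrite simple_int_cons (lebesgue_split mJ Joo me).
  rewrite (simple_int_split mJ Joo me mp).
  rewrite rmorphD /= scalerDl scalerDr -!addrA; congr (_ + _).
  by rewrite [LHS]addrCA; congr (_ + _); exact: addrCA.
have tri y1 y2 : ((nrm (y1 + y2 : X))%:E <= (nrm y1)%:E + (nrm y2)%:E)%E.
  by rewrite -EFinD lee_fin nrmD.
apply: le_trans (tri _ _) _; apply: leeD.
  apply: le_trans (IH _ _ mJe Jeoo mp) _; rewrite le_eqVlt; apply/orP; left; apply/eqP.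
  apply: eq_integral => t; rewrite inE /= => -[_ et].
  by rewrite simple_fun_cons indicE mem_set// scale1r addrA.
apply: le_trans (IH _ _ mJDe JDeoo mp) _; rewrite le_eqVlt; apply/orP; left; apply/eqP.
apply: eq_integral => t; rewrite inE /= => -[_ et].
by rewrite simple_fun_cons indicE memNset// scale0r add0r.
Qed.

Lemma nrm_simple_int J p :
  measurable J -> (mu J < +oo)%E -> simple_measurable p ->
  ((nrm (simple_int J p))%:E <= \int[mu]_(t in J) (nrm (simple_fun p t))%:E)%E.
Proof.
move=> mJ Joo mp; have := nrm_simple_int_shift 0 mJ Joo mp.
by rewrite scaler0 add0r; under eq_integral do rewrite add0r.
Qed.

Lemma nrm_simple_fun_bounded p :
  exists2 K : R, 0 <= K & forall t, nrm (simple_fun p t) <= K.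
Proof.
exists (\sum_(e <- p) nrm e.2) => [|t].
  by apply: sumr_ge0 => e _; exact: nrm_ge0.
apply: le_trans (nrm_sum _ _ _) _; apply: ler_sum => e _.
rewrite nrmZ indicE; case: (_ \in _); rewrite ?normr1 ?mul1r// normr0 mul0r.
exact: nrm_ge0.
Qed.

End SimpleFunctions.

Section SimpleMap.
Variables (R : realType) (X Y : completeNormedModType R[i]).
Variable L : {linear X -> Y}.
Implicit Types (p : seq (set R * X)).

Lemma simple_map_measurable p :
  simple_measurable p -> simple_measurable (simple_map L p).
Proof. by move=> mp e /mapP[e' /mp me' ->]. Qed.

Lemma simple_fun_map p t : simple_fun (simple_map L p) t = L (simple_fun p t).
Proof.
rewrite /simple_fun big_map linear_sum.
by apply: eq_bigr => e _; rewrite linearZ.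
Qed.

Lemma simple_int_map J p : simple_int J (simple_map L p) = L (simple_int J p).
Proof.
rewrite /simple_int big_map linear_sum.
by apply: eq_bigr => e _; rewrite linearZ.
Qed.

End SimpleMap.

(** * The Bochner integral *)

Section IntegralHelpers.
Variable R : realType.
Local Notation mu := (@lebesgue_measure R).

Lemma cvge0_near_lt (u : nat -> \bar R) : u n @[n --> \oo] --> 0%E ->
  forall e : R, 0 < e -> \forall n \near \oo, (u n < e%:E)%E.
Proof.
move=> /fine_cvgP[ufin /cvgrPdist_lt u0] e e0.
apply: filterS2 ufin (u0 _ e0) => n un; rewrite sub0r normrN => une.
by rewrite -(fineK un) lte_fin (le_lt_trans (ler_norm _)).
Qed.

Lemma le_integralD (D : set R) (u v w : R -> R) : measurable D ->
  measurable_fun D u -> measurable_fun D v -> measurable_fun D w ->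
  (forall t, D t -> 0 <= u t) -> (forall t, D t -> 0 <= v t) ->
  (forall t, D t -> 0 <= w t) -> (forall t, D t -> u t <= v t + w t) ->
  (\int[mu]_(t in D) (u t)%:E <=
   \int[mu]_(t in D) (v t)%:E + \int[mu]_(t in D) (w t)%:E)%E.
Proof.
move=> mD mu_ mv mw u0 v0 w0 uvw.
have mE f : measurable_fun D f -> measurable_fun D (fun t => (f t)%:E).
  by move=> mf; exact/measurable_EFinP.
rewrite -ge0_integralD//; [|exact: mE..].
apply: ge0_le_integral => //; first exact: mE.
by apply: emeasurable_funD; exact: mE.
Qed.

Lemma lebesgue_itvcc (a b : R) : a <= b -> mu `[a, b]%classic = (b - a)%:E.
Proof.
move=> ab; rewrite lebesgue_measure_itv /= lte_fin.
by case: ltgtP ab => // -> _; rewrite subrr.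
Qed.

Lemma lebesgue_itvcc_lty (a b : R) : (mu `[a, b]%classic < +oo)%E.
Proof.
have [ab|ba] := leP a b; first by rewrite lebesgue_itvcc// ltry.
by rewrite set_itv_ge ?measure0 ?ltry// bnd_simp -ltNge.
Qed.

End IntegralHelpers.

Section BochnerBasics.
Variables (R : realType) (X : completeNormedModType R[i]).
Implicit Types (F G : R -> X) (p q : nat -> seq (set R * X)) (a b : R).
Local Notation mu := (@lebesgue_measure R).

(** The part of [is_bochner] that does not mention the value of the integral:
    the value then exists by completeness and the same approximants serve
    every subinterval. *)
Definition approximates a b p F :=
  [/\ forall n, simple_measurable (p n),
      forall t, a <= t <= b -> simple_fun (p n) t @[n --> \oo] --> F t &
      (\int[mu]_(t in `[a, b]) (nrm (F t - simple_fun (p n) t))%:E)%E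
        @[n --> \oo] --> 0%E].

Lemma is_bochnerP a b F v : is_bochner a b F v <->
  exists2 p, approximates a b p F & simple_int `[a, b] (p n) @[n --> \oo] --> v.
Proof.
by split=> [[p [? ? ? ?]]|[p [? ? ?] ?]]; exists p.
Qed.

(** A norm of [F] minus a simple function is a pointwise limit of norms of
    simple functions.  The pointwise convergence is a hypothesis of its own
    because the lemma serves to prove convergence in mean. *)
Lemma measurable_nrm_subr a b F p (q : seq (set R * X)) :
  (forall n, simple_measurable (p n)) ->
  (forall t, a <= t <= b -> simple_fun (p n) t @[n --> \oo] --> F t) ->
  simple_measurable q ->
  measurable_fun `[a, b] (fun t => nrm (F t - simple_fun q t)).
Proof.
move=> mp pF mq.
apply: (@measurable_fun_cvg _ _ _ _
  (fun m t => nrm (0 + simple_fun (p m ++ simple_map -%R q) t))) => [m|t /=].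
  apply: measurable_nrm_simple => //; apply: simple_measurable_cat => //.
  exact: simple_map_measurable.
rewrite in_itv /= => /pF pFt; apply: cvg_nrm.
under eq_fun do rewrite add0r simple_fun_cat simple_fun_map.
by apply: cvgD => //; exact: cvg_cst.
Qed.

Lemma measurable_nrm a b F p : approximates a b p F ->
  measurable_fun `[a, b] (fun t => nrm (F t)).
Proof.
move=> [mp pF _]; have m0 : simple_measurable (X := X) [::] by move=> e; rewrite in_nil.
have := measurable_nrm_subr mp pF m0.
by under [X in measurable_fun _ X]eq_fun do rewrite /simple_fun big_nil subr0.
Qed.

Lemma measurable_nrm_simple_fun (D : set R) (q : seq (set R * X)) : measurable D ->
  simple_measurable q -> measurable_fun D (fun t => nrm (simple_fun q t)).
Proof.
move=> mD mq; have := measurable_nrm_simple 0 mD mq.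
by under [X in measurable_fun _ X]eq_fun do rewrite add0r.
Qed.

(** Passes to the limit in the inequality for simple functions. *)
Lemma nrm_is_bochner a b F v : is_bochner a b F v ->
  ((nrm v)%:E <= \int[mu]_(t in `[a, b]) (nrm (F t))%:E)%E.
Proof.
move=> /is_bochnerP[p pF /cvg_nrmP pv]; have [mp pFc p0] := pF.
apply/lee_addgt0Pr => e e0; have e20 : 0 < e / 2 by rewrite divr_gt0.
near \oo => n.
have h1 : nrm (simple_int `[a, b]%classic (p n) - v) < e / 2.
  near: n; move/cvgrPdist_lt : pv => /(_ _ e20); apply: filterS => n.
  by rewrite sub0r normrN ger0_norm ?nrm_ge0.
have h2 : (\int[mu]_(t in `[a, b]) (nrm (F t - simple_fun (p n) t))%:E
           < (e / 2)%:E)%E.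
  by near: n; exact: cvge0_near_lt.
have h3 :=
  nrm_simple_int (measurable_itv `[a, b]) (lebesgue_itvcc_lty a b) (mp n).
have h4 : (\int[mu]_(t in `[a, b]) (nrm (simple_fun (p n) t))%:E <=
  \int[mu]_(t in `[a, b]) (nrm (F t))%:E +
  \int[mu]_(t in `[a, b]) (nrm (F t - simple_fun (p n) t))%:E)%E.
  apply: le_integralD => //.
  - exact: measurable_nrm_simple_fun.
  - exact: measurable_nrm pF.
  - exact: measurable_nrm_subr mp pFc (mp n).
  - by move=> t _; exact: nrm_ge0.
  - by move=> t _; exact: nrm_ge0.
  - by move=> t _; exact: nrm_ge0.
  - by move=> t _; rewrite (le_trans _ (nrmB _ _))// opprB addrC subrK.
have -> : e = e / 2 + e / 2 by rewrite -splitr.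
rewrite EFinD addeA.
apply: (@le_trans _ _ ((nrm (simple_int `[a, b]%classic (p n)))%:E + (e / 2)%:E)%E).
  rewrite -EFinD lee_fin -lerBlDl (le_trans _ (ltW h1))//.
  by rewrite (le_trans (ler_norm _))// (le_trans (ler_dist_nrm _ _))// nrm_distC.
apply: leeD => //; apply: le_trans h3 _; apply: le_trans h4 _.
by apply: leeD => //; exact: ltW.
Unshelve. all: by end_near. Qed.

Lemma approximates_lt a b F p e : approximates a b p F -> 0 < e ->
  exists N, forall n m, (N <= n)%N -> (N <= m)%N ->
    (\int[mu]_(t in `[a, b]) (nrm (simple_fun (p n) t - simple_fun (p m) t))%:E
     < e%:E)%E.
Proof.
move=> pF e0; have [mp pFc p0] := pF; have e20 : 0 < e / 2 by rewrite divr_gt0.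
have [N _ pN] := cvge0_near_lt p0 e20; exists N => n m Nn Nm.
have h : (\int[mu]_(t in `[a, b])
              (nrm (simple_fun (p n) t - simple_fun (p m) t))%:E <=
  \int[mu]_(t in `[a, b]) (nrm (F t - simple_fun (p n) t))%:E +
  \int[mu]_(t in `[a, b]) (nrm (F t - simple_fun (p m) t))%:E)%E.
  apply: le_integralD => //; try by move=> t _; exact: nrm_ge0.
  - have := @measurable_nrm_simple_fun `[a, b] (p n ++ simple_map -%R (p m))
      (measurable_itv _).
    under [X in measurable_fun _ X]eq_fun
      do rewrite simple_fun_cat simple_fun_map.
    by apply; apply: simple_measurable_cat => //; exact: simple_map_measurable.
  - exact: measurable_nrm_subr mp pFc (mp n).
  - exact: measurable_nrm_subr mp pFc (mp m).
  - by move=> t _; rewrite (nrm_distC (F t)); exact: nrm_distD.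
apply: le_lt_trans h _; rewrite (splitr e) EFinD.
by apply: lteD; exact: pN.
Qed.

(** Convergence in mean makes the integrals of the approximants a Cauchy
    sequence. *)
Lemma approximates_integrable a b F p : approximates a b p F ->
  exists v : X, simple_int `[a, b] (p n) @[n --> \oo] --> v.
Proof.
move=> pF; have [mp _ _] := pF; apply: nrm_cauchy_cvg => e e0.
have [N pN] := approximates_lt pF e0; exists N => n m Nn Nm.
rewrite -lte_fin; apply: le_lt_trans (pN n m Nn Nm).
have mq : simple_measurable (p n ++ simple_map -%R (p m)).
  by apply: simple_measurable_cat => //; exact: simple_map_measurable.
have := nrm_simple_int (measurable_itv `[a, b]) (lebesgue_itvcc_lty a b) mq.
rewrite simple_int_cat simple_int_map.
by under eq_integral do rewrite simple_fun_cat simple_fun_map.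
Qed.

Lemma is_bochner_int_lty a b F v : is_bochner a b F v ->
  (\int[mu]_(t in `[a, b]) (nrm (F t))%:E < +oo)%E.
Proof.
move=> /is_bochnerP[p pF _]; have [mp pFc p0] := pF.
have [N _ /(_ N (leqnn N))/= pN] := cvge0_near_lt p0 ltr01.
have [K K0 pK] := nrm_simple_fun_bounded (p N).
have h : (\int[mu]_(t in `[a, b]) (nrm (F t))%:E <=
  \int[mu]_(t in `[a, b]) (nrm (F t - simple_fun (p N) t))%:E +
  \int[mu]_(t in `[a, b]) K%:E)%E.
  apply: le_integralD => //; try by move=> t _; exact: nrm_ge0.
  - exact: measurable_nrm pF.
  - exact: measurable_nrm_subr mp pFc (mp N).
  - move=> t _; rewrite -[X in nrm X <= _](subrK (simple_fun (p N) t)).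
    by rewrite (le_trans (nrmD _ _))// lerD.
apply: le_lt_trans h _; rewrite integral_cst//; apply: lte_add_pinfty.
  by rewrite (lt_trans pN)// ltry.
by apply: lte_mul_pinfty => //; exact: lebesgue_itvcc_lty.
Qed.

Lemma is_bochnerD a b F G v w : is_bochner a b F v -> is_bochner a b G w ->
  is_bochner a b (fun t => F t + G t) (v + w).
Proof.
move=> /is_bochnerP[p pF pv] /is_bochnerP[q qG qw].
have [mp pFc p0] := pF; have [mq qGc q0] := qG.
apply/is_bochnerP; exists (fun n => p n ++ q n); last first.
  by under eq_fun do rewrite simple_int_cat; apply: cvgD.
have mpq n : simple_measurable (p n ++ q n) by exact: simple_measurable_cat.
have pqc t : a <= t <= b -> simple_fun (p n ++ q n) t @[n --> \oo] --> F t + G t.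
  move=> tab; under eq_fun do rewrite simple_fun_cat.
  by apply: cvgD; [exact: pFc|exact: qGc].
split => //.
apply: (@squeeze_cvge _ _ _ _ (cst 0%E) _ (fun n =>
  \int[mu]_(t in `[a, b]) (nrm (F t - simple_fun (p n) t))%:E +
  \int[mu]_(t in `[a, b]) (nrm (G t - simple_fun (q n) t))%:E)%E).
- apply: nearW => n; apply/andP; split.
    by apply: integral_ge0 => t _; rewrite lee_fin nrm_ge0.
  apply: le_integralD => //; try by move=> t _; exact: nrm_ge0.
  + exact: (measurable_nrm_subr mpq pqc).
  + exact: measurable_nrm_subr mp pFc (mp n).
  + exact: measurable_nrm_subr mq qGc (mq n).
  + by move=> t _; rewrite simple_fun_cat opprD addrACA nrmD.
- exact: cvg_cst.
- by rewrite -[0%E]adde0; apply: cvgeD.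
Qed.

Lemma is_bochner_ext a b F G v : (forall t, a <= t <= b -> F t = G t) ->
  is_bochner a b F v -> is_bochner a b G v.
Proof.
move=> FG /is_bochnerP[p [mp pFc p0] pv]; apply/is_bochnerP; exists p => //.
split => // [t tab|]; first by rewrite -FG//; exact: pFc.
rewrite [X in X @ _ --> _](_ : _ = fun n =>
  \int[mu]_(t in `[a, b]) (nrm (F t - simple_fun (p n) t))%:E)%E//.
by apply/funext => n; apply: eq_integral => t; rewrite inE/= in_itv/= => /FG ->.
Qed.

End BochnerBasics.

Section BochnerLinear.
Variables (R : realType) (X Y : completeNormedModType R[i]).
Variables (L : {linear X -> Y}) (K : R).
Hypothesis LK : forall x, nrm (L x) <= K * nrm x.
Local Notation mu := (@lebesgue_measure R).

Lemma bounded_linear_cvg (T : Type) (F : set_system T) (FF : Filter F)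
    (u : T -> X) x :
  u t @[t --> F] --> x -> L (u t) @[t --> F] --> L x.
Proof.
move=> /cvg_nrmP ux; apply/cvg_nrmP.
apply: (@squeeze_cvgr _ _ _ _ (cst 0) (fun t => K * nrm (u t - x))).
- by apply: nearW => t; rewrite nrm_ge0 -linearB LK.
- exact: cvg_cst.
- by rewrite -[0](mulr0 K); apply: cvgM => //; exact: cvg_cst.
Qed.

(** A bounded linear map sends approximants of [F] to approximants of its
    image, with the mean distance multiplied by at most [|K|]. *)
Lemma is_bochner_linear (a b : R) (F : R -> X) v : is_bochner a b F v ->
  is_bochner a b (fun t => L (F t)) (L v).
Proof.
move=> /is_bochnerP[p pF pv]; have [mp pFc p0] := pF.
have mLp n : simple_measurable (simple_map L (p n)) by exact: simple_map_measurable.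
apply/is_bochnerP; exists (fun n => simple_map L (p n)); last first.
  by under eq_fun do rewrite simple_int_map; exact: bounded_linear_cvg.
have Lpc t : a <= t <= b ->
    simple_fun (simple_map L (p n)) t @[n --> \oo] --> L (F t).
  move=> tab; under eq_fun do rewrite simple_fun_map.
  by apply: bounded_linear_cvg; exact: pFc.
split => //.
have K0 : 0 <= `|K| by [].
apply: (@squeeze_cvge _ _ _ _ (cst 0%E) _ (fun n => `|K|%:E *
  \int[mu]_(t in `[a, b]) (nrm (F t - simple_fun (p n) t))%:E)%E).
- apply: nearW => n; apply/andP; split.
    by apply: integral_ge0 => t _; rewrite lee_fin nrm_ge0.
  have mFp := measurable_nrm_subr mp pFc (mp n).
  rewrite -ge0_integralZl//; last 2 first.
  + exact/measurable_EFinP.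
  + by move=> t _; rewrite lee_fin nrm_ge0.
  apply: ge0_le_integral => //.
  + by move=> t _; rewrite lee_fin nrm_ge0.
  + by apply/measurable_EFinP; exact: (measurable_nrm_subr mLp Lpc).
  + apply/measurable_EFinP; apply: measurable_funM => //; exact: measurable_cst.
  + move=> t _; rewrite lee_fin simple_fun_map -linearB (le_trans (LK _))//.
    by rewrite ler_wpM2r ?nrm_ge0// ler_norm.
- exact: cvg_cst.
- by rewrite -[0%E](mule0 `|K|%:E); apply: cvgeZl.
Qed.

End BochnerLinear.

Section BochnerTheory.
Variables (R : realType) (X : completeNormedModType R[i]).
Implicit Types (F G : R -> X) (a b c : R) (v w x : X).
Local Notation mu := (@lebesgue_measure R).

Lemma is_bochnerN a b F v : is_bochner a b F v ->
  is_bochner a b (fun t => - F t) (- v).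
Proof.
by apply: (@is_bochner_linear _ _ _ -%R 1) => x /=; rewrite nrmN mul1r.
Qed.

Lemma is_bochnerB a b F G v w : is_bochner a b F v -> is_bochner a b G w ->
  is_bochner a b (fun t => F t - G t) (v - w).
Proof. by move=> Fv /is_bochnerN; exact: is_bochnerD. Qed.

Lemma is_bochnerZ a b F v (k : R[i]) : is_bochner a b F v ->
  is_bochner a b (fun t => k *: F t) (k *: v).
Proof.
by apply: (@is_bochner_linear _ _ _ ( *:%R k) (complex.Re `|k|)) => x; rewrite nrmZc.
Qed.

Lemma is_bochner0 a b : is_bochner a b (fun=> 0 : X) 0.
Proof.
apply/is_bochnerP; exists (fun=> [::]) => [|]; last first.
  by under eq_fun do rewrite /simple_int big_nil; exact: cvg_cst.
split => [n e|t _|]; first by rewrite in_nil.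
  by under eq_fun do rewrite /simple_fun big_nil; exact: cvg_cst.
rewrite [X in X @ _ --> _](_ : _ = cst 0%E); first exact: cvg_cst.
apply/funext => n; rewrite (eq_integral (cst 0%E)) ?integral0// => t _.
by rewrite /simple_fun big_nil subr0 nrm0.
Qed.

Lemma is_bochner_sum a b n (F : 'I_n -> R -> X) (v : 'I_n -> X) :
  (forall i, is_bochner a b (F i) (v i)) ->
  is_bochner a b (fun t => \sum_(i < n) F i t) (\sum_(i < n) v i).
Proof.
elim: n F v => [|n IH] F v Fv.
  rewrite big_ord0; apply: is_bochner_ext (is_bochner0 a b) => t _.
  by rewrite big_ord0.
rewrite big_ord_recr/=; apply: (is_bochner_ext _ (is_bochnerD (IH _ _ _) (Fv ord_max))).
  by move=> t _; rewrite big_ord_recr/=.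
by move=> i; exact: Fv.
Qed.

(** The difference of two values is a value of the integral of [F - F], whose
    norm is at most the integral of 0. *)
Lemma is_bochner_unique a b F v w :
  is_bochner a b F v -> is_bochner a b F w -> v = w.
Proof.
move=> Fv Fw; have := nrm_is_bochner (is_bochnerB Fv Fw).
rewrite (eq_integral (cst 0%E)); last by move=> t _; rewrite subrr nrm0.
rewrite integral0 lee_fin => vw; apply/eqP; rewrite -subr_eq0; apply/eqP/nrm_eq0.
by apply/eqP; rewrite eq_le vw nrm_ge0.
Qed.

Lemma bochnerP a b F : bochner_integrable a b F -> is_bochner a b F (bochner a b F).
Proof. exact: xgetPex. Qed.

Lemma bochner_eq a b F v : is_bochner a b F v -> bochner a b F = v.
Proof. by move=> Fv; apply: (is_bochner_unique _ Fv); apply: bochnerP; exists v. Qed.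

Lemma nrm_is_bochner_le a b F v (K : R) : a <= b -> is_bochner a b F v ->
  (forall t, a <= t <= b -> nrm (F t) <= K) -> nrm v <= K * (b - a).
Proof.
move=> ab Fv FK; rewrite -lee_fin; apply: le_trans (nrm_is_bochner Fv) _.
have [p pF _] := (is_bochnerP a b F v).1 Fv.
have -> : ((K * (b - a))%:E = \int[mu]_(t in `[a, b]) (cst K%:E) t)%E.
  by rewrite integral_cst// EFinM; congr (_ * _)%E; rewrite -(lebesgue_itvcc ab).
apply: ge0_le_integral => //.
- by move=> t _; rewrite lee_fin nrm_ge0.
- by apply/measurable_EFinP; exact: measurable_nrm pF.
Qed.

(** Serves to split the closed interval [[a, b]] into closed intervals, which
    overlap at the common endpoint. *)
Lemma simple_int_null (J N : set R) (p : seq (set R * X)) :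
  measurable J -> measurable N -> mu N = 0%E -> simple_measurable p ->
  simple_int (J `|` N) p = simple_int J p.
Proof.
move=> mJ mN N0; elim: p => [|e p IH] mp; first by rewrite /simple_int !big_nil.
have [me {}mp] := simple_measurable_cons mp.
rewrite !simple_int_cons IH//; congr ((fine _)%:C *: _ + _).
rewrite setIUl; apply: measureU0; try exact: measurableI.
apply/eqP; rewrite eq_le measure_ge0 andbT -N0.
by apply: le_measure; rewrite ?inE//; exact: measurableI.
Qed.

Lemma simple_int_itv_split a b c (p : seq (set R * X)) : a <= c <= b ->
  simple_measurable p ->
  simple_int `[a, b] p = simple_int `[a, c] p + simple_int `[c, b] p.
Proof.
move=> /andP[ac cb] mp.
rewrite (@simple_int_split _ _ `[a, b] `[a, c])//; last exact: lebesgue_itvcc_lty.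
congr (_ + _).
  congr simple_int; apply/seteqP; split => t /=; rewrite !in_itv/=; first by case.
  by move=> /andP[-> tc]; rewrite (le_trans tc cb).
have -> : (`[c, b] = (`[a, b] `\` `[a, c]) `|` [set c])%classic.
  apply/seteqP; split => t /=; rewrite !in_itv/=.
    move=> /andP[ct tb]; have [->|tc] := eqVneq t c; [by right|left].
    rewrite tb (le_trans ac ct)/=; split => //; apply/negP; rewrite -ltNge.
    by rewrite lt_neqAle eq_sym tc.
  case=> [[/andP[at_ tb] /negP]|->]; last by rewrite lexx.
  by rewrite at_/= -ltNge tb andbT => /ltW.
rewrite simple_int_null//; first exact: measurableD.
exact: lebesgue_measure_set1.
Qed.

Lemma approximates_sub a b a' b' F p : a <= a' -> b' <= b ->
  approximates a b p F -> approximates a' b' p F.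
Proof.
move=> aa' bb' pF; have [mp pFc p0] := pF.
have sub : [set` `[a', b']] `<=` [set` `[a, b]].
  by apply: subset_itv; rewrite bnd_simp.
split => // [t /andP[at_ tb]|].
  by apply: pFc; rewrite (le_trans aa' at_) (le_trans tb bb').
apply: (@squeeze_cvge _ _ _ _ (cst 0%E) _ (fun n =>
  \int[mu]_(t in `[a, b]) (nrm (F t - simple_fun (p n) t))%:E)%E) => //; last exact: cvg_cst.
apply: nearW => n; apply/andP; split.
  by apply: integral_ge0 => t _; rewrite lee_fin nrm_ge0.
apply: ge0_subset_integral => //.
  by apply/measurable_EFinP; exact: measurable_nrm_subr mp pFc (mp n).
by move=> t _; rewrite lee_fin nrm_ge0.
Qed.

Lemma bochner_integrable_sub a b a' b' F : a <= a' -> b' <= b ->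
  bochner_integrable a b F -> bochner_integrable a' b' F.
Proof.
move=> aa' bb' [v /is_bochnerP[p /(approximates_sub aa' bb') pF _]].
have [w pw] := approximates_integrable pF.
by exists w; apply/is_bochnerP; exists p.
Qed.

(** The same approximants compute all three integrals, so the identity is
    inherited from simple functions. *)
Lemma bochner_split a b c F : a <= c <= b -> bochner_integrable a b F ->
  bochner a b F = bochner a c F + bochner c b F.
Proof.
move=> acb [v Fv]; have /andP[ac cb] := acb; rewrite (bochner_eq Fv).
have /is_bochnerP[p pF pv] := Fv; have [mp _ _] := pF.
have [v1 pv1] := approximates_integrable (approximates_sub (lexx a) cb pF).
have [v2 pv2] := approximates_integrable (approximates_sub ac (lexx b) pF).
rewrite (@bochner_eq a c F v1); last first.
  by apply/is_bochnerP; exists p => //; exact: approximates_sub pF.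
rewrite (@bochner_eq c b F v2); last first.
  by apply/is_bochnerP; exists p => //; exact: approximates_sub pF.
have pv12 : simple_int `[a, b] (p n) @[n --> \oo] --> v1 + v2.
  by under eq_fun do rewrite (simple_int_itv_split acb)//; apply: cvgD.
by apply: cvg_unique pv pv12; exact: norm_hausdorff.
Qed.

End BochnerTheory.

(** * Continuous integrands and Riemann sums *)

Section Riemann.
Variables (R : realType) (X : completeNormedModType R[i]).
Implicit Types (F : R -> X) (a b : R).
Local Notation mu := (@lebesgue_measure R).

Definition mesh a b n : R := (b - a) / n.+1%:R.

Definition mesh_node a b n k : R := a + k%:R * mesh a b n.

Definition riemann_sum a b F n : X :=
  (mesh a b n)%:C *: \sum_(0 <= k < n.+1) F (mesh_node a b n k).

Definition step_cells a b F n m : seq (set R * X) :=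
  [seq ([set` `[mesh_node a b n k, mesh_node a b n k.+1[], F (mesh_node a b n k))
    | k <- iota 0 m].

(** The half-open cells leave out the right endpoint [b], so the value there
    is put in by a null set; this makes the step functions converge at every
    point of the closed interval, also when [a = b]. *)
Definition step_approx a b F n : seq (set R * X) :=
  step_cells a b F n n.+1 ++ [:: ([set b], F b)].

Lemma mesh_ge0 a b n : a <= b -> 0 <= mesh a b n.
Proof. by move=> ab; rewrite divr_ge0// subr_ge0. Qed.

Lemma mesh_node0 a b n : mesh_node a b n 0 = a.
Proof. by rewrite /mesh_node mul0r addr0. Qed.

Lemma mesh_nodeS a b n k : mesh_node a b n k.+1 = mesh_node a b n k + mesh a b n.
Proof. by rewrite /mesh_node -natr1 mulrDl mul1r addrA. Qed.

Lemma mesh_node_last a b n : mesh_node a b n n.+1 = b.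
Proof. by rewrite /mesh_node /mesh mulrC divfK ?pnatr_eq0// addrC subrK. Qed.

Lemma mesh_node_le a b n k l : a <= b -> (k <= l)%N ->
  mesh_node a b n k <= mesh_node a b n l.
Proof.
by move=> ab kl; rewrite /mesh_node lerD2l ler_wpM2r ?mesh_ge0// ler_nat.
Qed.

Lemma mesh_node_itv a b n k : a <= b -> (k <= n.+1)%N -> a <= mesh_node a b n k <= b.
Proof.
move=> ab kn; apply/andP; split.
  by rewrite -[X in X <= _](mesh_node0 a b n) mesh_node_le.
by rewrite -[X in _ <= X](mesh_node_last a b n) mesh_node_le.
Qed.

Lemma mesh_cvg0 a b : mesh a b n @[n --> \oo] --> 0.
Proof.
rewrite -[0](mulr0 (b - a)).
apply: (@cvgM _ _ _ _ (cst (b - a)) harmonic); first exact: cvg_cst.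
exact: cvg_harmonic.
Qed.

Lemma step_cellsS a b F n m : step_cells a b F n m.+1 = step_cells a b F n m ++
  [:: ([set` `[mesh_node a b n m, mesh_node a b n m.+1[], F (mesh_node a b n m))].
Proof. by rewrite /step_cells -[in LHS]addn1 iotaD map_cat. Qed.

Lemma simple_fun1 (e : set R * X) t : simple_fun [:: e] t = (\1_(e.1) t)%:C *: e.2.
Proof. by rewrite /simple_fun big_seq1. Qed.

Lemma simple_int1 J (e : set R * X) :
  simple_int J [:: e] = (fine (mu (J `&` e.1)))%:C *: e.2.
Proof. by rewrite /simple_int big_seq1. Qed.

Lemma step_cells_out a b F n m t : a <= b -> mesh_node a b n m <= t ->
  simple_fun (step_cells a b F n m) t = 0.
Proof.
move=> ab; elim: m => [|m IH] mt; first by rewrite /simple_fun big_nil.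
rewrite step_cellsS simple_fun_cat IH; last first.
  by apply: le_trans mt; exact: mesh_node_le.
rewrite simple_fun1 indicE memNset ?scale0r ?addr0//= in_itv/= => /andP[_].
by rewrite ltNge mt.
Qed.

Lemma step_cells_in a b F n m t : a <= b -> a <= t < mesh_node a b n m ->
  exists k, [/\ (k < m)%N, mesh_node a b n k <= t < mesh_node a b n k.+1 &
    simple_fun (step_cells a b F n m) t = F (mesh_node a b n k)].
Proof.
move=> ab; elim: m => [|m IH] /andP[at_ tm].
  by move: tm; rewrite mesh_node0 ltNge at_.
rewrite step_cellsS simple_fun_cat simple_fun1.
have [mt|tm'] := leP (mesh_node a b n m) t.
  exists m; split => //; first by rewrite mt.
  rewrite step_cells_out// add0r indicE mem_set ?scale1r//=.
  by rewrite in_itv/= mt.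
have [|k [km kt ->]] := IH; first by rewrite at_.
exists k; split => //; first exact: ltnW.
rewrite indicE memNset ?scale0r ?addr0//= in_itv/= => /andP[].
by rewrite leNgt tm'.
Qed.

Lemma step_approx_near a b F n t : a <= t <= b ->
  exists r, [/\ a <= r <= b, `|t - r| <= mesh a b n &
    simple_fun (step_approx a b F n) t = F r].
Proof.
move=> /andP[at_ tb]; have ab := le_trans at_ tb.
rewrite /step_approx simple_fun_cat simple_fun1 /=.
have [tb'|bt] := ltP t b.
  have [|k [kn /andP[kt tk] ->]] := @step_cells_in a b F n n.+1 t ab.
    by rewrite at_ mesh_node_last.
  exists (mesh_node a b n k); split; first exact/mesh_node_itv/ltnW.
    rewrite ger0_norm ?subr_ge0// lerBlDl -mesh_nodeS; exact: ltW.
  rewrite indicE memNset ?scale0r ?addr0//= => tb''.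
  by rewrite tb'' ltxx in tb'.
have -> : t = b by apply/eqP; rewrite eq_le tb.
exists b; split; first by rewrite ab lexx.
  by rewrite subrr normr0 mesh_ge0.
rewrite step_cells_out ?mesh_node_last// add0r indicE mem_set//.
by rewrite scale1r.
Qed.

Lemma step_approx_measurable a b F n : simple_measurable (step_approx a b F n).
Proof.
apply: simple_measurable_cat.
  by move=> e /mapP[k _ ->] /=; exact: measurable_itv.
by move=> e; rewrite inE => /eqP -> /=.
Qed.

Lemma simple_int_step_cells a b F n m : a <= b -> (m <= n.+1)%N ->
  simple_int `[a, b] (step_cells a b F n m) =
  (mesh a b n)%:C *: \sum_(0 <= k < m) F (mesh_node a b n k).
Proof.
move=> ab; elim: m => [|m IH] mn.
  by rewrite /simple_int big_nil big_geq// scaler0.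
rewrite step_cellsS simple_int_cat IH ?(ltnW mn)// big_nat_recr//= scalerDr.
rewrite simple_int1 /=; congr (_ + (_)%:C *: _).
rewrite setIidr; last first.
  apply: subset_itv; rewrite bnd_simp.
    by have /andP[] := mesh_node_itv ab (ltnW mn).
  by have /andP[] := mesh_node_itv ab mn.
have := @lebesgue_measure_itv R `[mesh_node a b n m, mesh_node a b n m.+1[.
rewrite /= lte_fin mesh_nodeS => ->.
case: ifPn => [_|]; first by rewrite /= addrAC subrr add0r.
rewrite ltrDl -leNgt => m0 /=.
by apply/eqP; rewrite eq_le m0 mesh_ge0.
Qed.

Lemma simple_int_step_approx a b F n : a <= b ->
  simple_int `[a, b] (step_approx a b F n) = riemann_sum a b F n.
Proof.
move=> ab; rewrite /step_approx simple_int_cat simple_int_step_cells//.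
rewrite simple_int1/= (_ : mu _ = 0%E) ?scale0r ?addr0//.
apply/eqP; rewrite eq_le measure_ge0 andbT -(lebesgue_measure_set1 b).
by apply: le_measure; rewrite ?inE//; exact: measurableI.
Qed.

(** Step functions on a uniform mesh converge pointwise by continuity and are
    bounded by the maximum of the norm, so dominated convergence gives
    convergence in mean.  That the integral is also a limit of Riemann sums
    makes it computable: shifts and monomials are treated in this way. *)
Lemma continuous_is_bochner a b F : a <= b -> {within `[a, b], continuous F} ->
  exists2 v, is_bochner a b F v & riemann_sum a b F n @[n --> \oo] --> v.
Proof.
move=> ab cF; have [K FK] : exists K, forall t, a <= t <= b -> nrm (F t) <= K.
  have [|c _ cmax] := @EVT_max R (fun t => nrm (F t)) a b ab.
    apply/subspace_continuousP => t tab; apply: cvg_nrm.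
    by move/subspace_continuousP : cF => /(_ t tab).
  by exists (nrm (F c)) => t tab; apply: cmax; rewrite in_itv.
pose p n := step_approx a b F n.
have mp n : simple_measurable (p n) by exact: step_approx_measurable.
have pF t : a <= t <= b -> simple_fun (p n) t @[n --> \oo] --> F t.
  move=> tab; apply/cvg_nrmP/cvgrPdist_lt => e e0.
  have /subspace_continuousP/(_ t) := cF; rewrite /= in_itv/= => /(_ tab).
  move=> /cvg_nrmP/cvgrPdist_lt/(_ _ e0) [d /= d0 dF].
  have := mesh_cvg0 a b; move=> /cvgrPdist_lt/(_ _ d0); apply: filterS => n.
  rewrite sub0r normrN ger0_norm ?mesh_ge0// => nd.
  have [r [rab tr ->]] := step_approx_near F n tab.
  by apply: dF => /=; rewrite ?in_itv//=; exact: le_lt_trans nd.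
have pF' : approximates a b p F.
  split => //.
  have [|||||] := @dominated_convergence _ _ R mu `[a, b]%classic (measurable_itv _)
    (fun n t => (nrm (F t - simple_fun (p n) t))%:E) (cst 0%E) (cst (K + K)%:E).
  - by move=> n; apply/measurable_EFinP; exact: (measurable_nrm_subr mp pF).
  - exact: measurable_cst.
  - apply: aeW => t /=; rewrite in_itv/= => tab; apply: cvg_EFin.
      by apply: nearW.
    move: (pF t tab) => /cvg_nrmP; apply: cvg_trans.
    by under eq_fun do rewrite /= nrm_distC.
  - apply/integrableP; split; first exact: measurable_cst.
    rewrite integral_cst//; apply: lte_mul_pinfty => //.
    exact: lebesgue_itvcc_lty.
  - apply: aeW => t n /=; rewrite in_itv/= => tab.
    rewrite ger0_norm ?nrm_ge0// lee_fin (le_trans (nrmB _ _))// lerD ?FK//.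
    by have [r [rab _ ->]] := step_approx_near F n tab; exact: FK.
  by move=> _ _; rewrite integral0.
have [v pv] := approximates_integrable pF'.
exists v; first by apply/is_bochnerP; exists p.
by move: pv; under eq_fun do rewrite simple_int_step_approx//.
Qed.

End Riemann.

Section ContinuousIntegrals.
Variables (R : realType) (X : completeNormedModType R[i]).
Implicit Types (F G : R -> X) (a b : R).

Lemma within_continuous_nrmP a b F : {within `[a, b], continuous F} <->
  forall t, a <= t <= b -> forall e : R, 0 < e -> exists2 d : R, 0 < d &
    forall r, a <= r <= b -> `|t - r| < d -> nrm (F r - F t) < e.
Proof.
split.
- move=> /subspace_continuousP cF t tab e e0.
  have := cF t; rewrite /= in_itv/= => /(_ tab) /cvg_nrmP/cvgrPdist_lt/(_ _ e0).
  move=> [d /= d0 dF]; exists d => // r rab tr.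
  have := dF r tr; rewrite in_itv/= => /(_ rab).
  by rewrite sub0r normrN ger0_norm ?nrm_ge0.
- move=> cF; apply/subspace_continuousP => t; rewrite /= in_itv/= => tab.
  apply/cvg_nrmP/cvgrPdist_lt => e e0; have [d d0 dF] := cF t tab e e0.
  exists d => //= r tr; rewrite in_itv/= => rab.
  by rewrite sub0r normrN ger0_norm ?nrm_ge0// dF.
Qed.

Lemma within_continuous_sub a b a' b' F : a <= a' -> b' <= b ->
  {within `[a, b], continuous F} -> {within `[a', b'], continuous F}.
Proof.
by move=> aa' bb'; apply: continuous_subspaceW; apply: subset_itv; rewrite bnd_simp.
Qed.

Lemma within_continuous_shift a b c F :
  {within `[a + c, b + c], continuous F} ->
  {within `[a, b], continuous (fun t => F (t + c))}.
Proof.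
move=> /within_continuous_nrmP cF; apply/within_continuous_nrmP => t tab e e0.
have [|d d0 dF] := cF (t + c) _ e e0; first by rewrite !lerD2r.
exists d => // r rab tr; apply: dF; first by rewrite !lerD2r.
by rewrite opprD addrACA subrr addr0.
Qed.

Lemma within_continuousZ a b (k : R -> R) F : continuous k ->
  {within `[a, b], continuous F} ->
  {within `[a, b], continuous (fun t => (k t)%:C *: F t)}.
Proof.
move=> ck /subspace_continuousP cF; apply/subspace_continuousP => t tab.
have kt : k r @[r --> within `[a, b]%classic (nbhs t)] --> k t.
  by apply: cvg_within_filter; exact: ck.
apply/cvg_nrmP.
apply: (@squeeze_cvgr _ _ _ _ (cst 0)
  (fun r => `|k r| * nrm (F r - F t) + `|k r - k t| * nrm (F t))).
- apply: nearW => r; rewrite nrm_ge0 -!nrmZ (le_trans _ (nrmD _ _))//.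
  by rewrite scalerBr rmorphB /= scalerBl addrA subrK.
- exact: cvg_cst.
- rewrite -[0](addr0 0) -{1}(mulr0 `|k t|) -{2}(mul0r (nrm (F t))).
  apply: cvgD; apply: cvgM; [exact: cvg_norm|exact/cvg_nrmP/cF| |exact: cvg_cst].
  rewrite -(normr0 R); apply: cvg_norm; rewrite -(subrr (k t)).
  by apply: cvgB => //; exact: cvg_cst.
Qed.

Lemma continuous_bochner a b F : a <= b -> {within `[a, b], continuous F} ->
  bochner_integrable a b F.
Proof. by move=> ab /(continuous_is_bochner ab)[v Fv _]; exists v. Qed.

(** Both integrals are limits of the same Riemann sums. *)
Lemma bochner_shift a b c F : a <= b -> {within `[a + c, b + c], continuous F} ->
  bochner (a + c) (b + c) F = bochner a b (fun t => F (t + c)).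
Proof.
move=> ab cF; have abc : a + c <= b + c by rewrite lerD2r.
have [v Fv sv] := continuous_is_bochner abc cF.
have [w Fw sw] := continuous_is_bochner ab (within_continuous_shift cF).
rewrite (bochner_eq Fv) (bochner_eq Fw).
have e : riemann_sum (a + c) (b + c) F = riemann_sum a b (fun t => F (t + c)).
  apply/funext => n; rewrite /riemann_sum.
  have hm : mesh (a + c) (b + c) n = mesh a b n.
    by rewrite /mesh opprD addrACA subrr addr0.
  rewrite hm; congr (_ *: _); apply: eq_bigr => k _; congr F.
  by rewrite /mesh_node hm addrAC.
by rewrite e in sv; apply: cvg_unique sv sw; exact: norm_hausdorff.
Qed.

End ContinuousIntegrals.

Section Monomials.
Variables (R : realType) (X : completeNormedModType R[i]).

(** The mean value bounds for the power [j.+1] on [[x, y]], in the elementary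
    form obtained by bounding every term of [(y^(j+1) - x^(j+1)) / (y - x)]. *)
Lemma exprnS_bounds (x y : R) j : 0 <= x -> x <= y ->
  x ^+ j * (y - x) *+ j.+1 <= y ^+ j.+1 - x ^+ j.+1 <= y ^+ j * (y - x) *+ j.+1.
Proof.
move=> x0 xy; have y0 := le_trans x0 xy; have yx0 : 0 <= y - x by rewrite subr_ge0.
rewrite subrXX [_ * \sum_(_ < _) _]mulrC -!mulrnAl.
rewrite -[x ^+ j *+ _](_ : \sum_(i < j.+1) x ^+ j = _); last first.
  by rewrite sumr_const card_ord.
rewrite -[y ^+ j *+ _](_ : \sum_(i < j.+1) y ^+ j = _); last first.
  by rewrite sumr_const card_ord.
apply/andP; split; apply: ler_wpM2r => //; apply: ler_sum => i _ /=;
  have ij : j = (j - i + i)%N by rewrite subnK// -ltnS.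
- by rewrite [X in x ^+ X <= _]ij exprD ler_wpM2r ?exprn_ge0// lerXn2r// ?nnegrE.
- by rewrite [X in _ <= y ^+ X]ij exprD ler_wpM2l ?exprn_ge0// lerXn2r// ?nnegrE.
Qed.

(** By the mean value bounds, the integral over one cell lies between the
    rectangles of its left and of its right endpoint.  The difference of the
    two sums of rectangles telescopes, to at most one mesh width times the
    value at [x]. *)
Lemma riemann_monomial (x : R) j n : 0 <= x ->
  `|mesh 0 x n * (\sum_(0 <= k < n.+1) mesh_node 0 x n k ^+ j / j`!%:R) -
    x ^+ j.+1 / j.+1`!%:R| <= mesh 0 x n * (x ^+ j / j`!%:R).
Proof.
move=> x0; set h := mesh 0 x n; pose y := mesh_node 0 x n.
have h0 : 0 <= h by exact: mesh_ge0.
have y0 k : 0 <= y k by rewrite /y /mesh_node add0r mulr_ge0.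
have yS k : y k.+1 - y k = h by rewrite /y mesh_nodeS addrC addKr.
have yk k : y k <= y k.+1 by rewrite -subr_ge0 yS.
have tele i : \sum_(0 <= k < n.+1) (y k.+1 ^+ i - y k ^+ i) = x ^+ i - 0 ^+ i.
  by rewrite telescope_sumr// /y mesh_node_last mesh_node0.
have lo : h * (\sum_(0 <= k < n.+1) y k ^+ j) *+ j.+1 <= x ^+ j.+1.
  rewrite -[leRHS]subr0 -[X in _ - X](expr0n R j.+1) -tele mulr_sumr -sumrMnl.
  apply: ler_sum => k _; have /andP[+ _] := exprnS_bounds j (y0 k) (yk k).
  by rewrite yS mulrC.
have hi : x ^+ j.+1 <= (h * (\sum_(0 <= k < n.+1) y k ^+ j) + h * x ^+ j) *+ j.+1.
  rewrite -[leLHS]subr0 -[X in _ - X](expr0n R j.+1) -tele.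
  apply: (@le_trans _ _ (\sum_(0 <= k < n.+1) (h * y k.+1 ^+ j) *+ j.+1)).
    apply: ler_sum => k _; have /andP[_] := exprnS_bounds j (y0 k) (yk k).
    by rewrite yS mulrC.
  rewrite sumrMnl lerMn2r/= -mulr_sumr -mulrDr ler_wpM2l// -lerBlDl.
  by rewrite -sumrB tele lerBlDr lerDl exprn_ge0.
move: lo hi; rewrite -mulr_suml factS natrM.
set Y := \sum_(0 <= k < n.+1) _; rewrite -(mulr_natr (h * Y)) -(mulr_natr (_ + _)).
have : 0 < j.+1%:R :> R by rewrite ltr0n.
have : 0 < j`!%:R :> R by rewrite ltr0n fact_gt0.
move: (j`!%:R : R) (j.+1%:R : R) (x ^+ j.+1) (x ^+ j) => f c P Q f0 c0 lo hi.
have [fn0 cn0] : f != 0 /\ c != 0 by rewrite !gt_eqF.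
have -> : h * (Y / f) - P / (c * f) = - ((P - h * Y * c) / (c * f)).
  by field; rewrite fn0 cn0.
rewrite normrN ger0_norm; last by rewrite divr_ge0 ?subr_ge0// ltW// mulr_gt0.
rewrite ler_pdivrMr ?mulr_gt0// (_ : _ * (c * f) = h * Q * c); last by field.
by rewrite lerBlDl -mulrDl.
Qed.

Lemma is_bochner_monomial (x : R) j (v : X) : 0 <= x ->
  is_bochner 0 x (fun t => (t ^+ j / j`!%:R)%:C *: v)
    ((x ^+ j.+1 / j.+1`!%:R)%:C *: v).
Proof.
move=> x0.
have cm : {within `[0, x], continuous (fun t : R => (t ^+ j / j`!%:R)%:C *: v)}.
  apply: within_continuousZ.
    by move=> t; apply: cvgM; [exact: exprn_continuous|exact: cvg_cst].
  by apply/subspace_continuousP => t _; exact: cvg_cst.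
have [w Fw sw] := continuous_is_bochner x0 cm.
suff sv : riemann_sum 0 x (fun t => (t ^+ j / j`!%:R)%:C *: v) n @[n --> \oo] -->
    (x ^+ j.+1 / j.+1`!%:R)%:C *: v.
  have <- // : w = (x ^+ j.+1 / j.+1`!%:R)%:C *: v.
  by apply: cvg_unique sw sv; exact: norm_hausdorff.
apply/cvg_nrmP; apply: (@squeeze_cvgr _ _ _ _ (cst 0)
  (fun n => mesh 0 x n * (x ^+ j / j`!%:R) * nrm v)).
- apply: nearW => n; rewrite nrm_ge0 /riemann_sum -scaler_suml scalerA.
  rewrite -(rmorph_sum (real_complex R)) -rmorphM -scalerBl -rmorphB nrmZ.
  by rewrite ler_wpM2r ?nrm_ge0// riemann_monomial.
- exact: cvg_cst.
- rewrite [X in _ --> X](_ : 0 = 0 * (x ^+ j / j`!%:R) * nrm v); last first.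
    by rewrite !mul0r.
  apply: (@cvgM _ _ _ _ (fun n => mesh 0 x n * _) (cst (nrm v))); last exact: cvg_cst.
  by apply: (@cvgM _ _ _ _ (mesh 0 x) (cst _)); [exact: mesh_cvg0|exact: cvg_cst].
Qed.

End Monomials.

(** * Uniform boundedness *)

Section UniformBoundedness.
Variables (R : realType) (X : completeNormedModType R[i]) (I : Type).
Variable L : I -> {linear X -> X}.
Hypothesis contL : forall i, continuous (L i).
Hypothesis ptbL : forall x, exists K, forall i, nrm (L i x) <= K.

(** If all operators were at most [K] on the ball, then by linearity they
    would be at most [2K] on its translate to the origin, hence uniformly
    bounded. *)
Lemma unbounded_on_ball (x : X) (r K : R) : 0 < r ->
  ~ (exists2 C, 0 <= C & forall i u, nrm (L i u) <= C * nrm u) ->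
  exists i y, nrm (y - x) < r /\ K < nrm (L i y).
Proof.
move=> r0; apply: contra_notP => H.
have {}H i y : nrm (y - x) < r -> nrm (L i y) <= K.
  by move=> yr; rewrite leNgt; apply/negP => ?; apply: H; exists i, y.
have K0 (i : I) : 0 <= K.
  by apply: (le_trans (nrm_ge0 (L i x))); apply: H; rewrite subrr nrm0.
exists `|(K + K) * (2 / r)|; first by [].
move=> i u; have [->|u0] := eqVneq u 0; first by rewrite linear0 !nrm0 mulr0.
have nu : 0 < nrm u.
  by rewrite lt_neqAle nrm_ge0 andbT eq_sym; apply: contraNneq u0 => /nrm_eq0 ->.
set k := r / 2 / nrm u; have k0 : 0 < k by rewrite !divr_gt0.
have ku : nrm (k%:C *: u) = r / 2 by rewrite nrmZ gtr0_norm// divfK ?gt_eqF.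
have Lku : nrm (L i (k%:C *: u)) <= K + K.
  rewrite -[k%:C *: u](addrK x) linearB (le_trans (nrmB _ _))//.
  rewrite lerD ?H ?subrr ?nrm0// addrK ku.
  by rewrite ltr_pdivrMr// ltr_pMr// ltr1n.
have c0 : 0 <= (K + K) * (2 / r).
  by rewrite mulr_ge0 ?addr_ge0 ?(K0 i)// divr_ge0// ltW.
rewrite (ger0_norm c0).
have Lu : nrm (L i u) <= k^-1 * (K + K).
  by move: Lku; rewrite linearZ nrmZ gtr0_norm// ler_pdivlMl.
rewrite (le_trans Lu)// le_eqVlt; apply/orP; left; apply/eqP.
by rewrite /k; field; rewrite !gt_eqF.
Qed.

(** The Banach-Steinhaus theorem by nested balls: if it fails, every ball
    contains a smaller closed ball on which some operator exceeds [n].  The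
    common point of the nested balls contradicts pointwise boundedness. *)
Lemma uniform_boundedness :
  exists2 C, 0 <= C & forall i u, nrm (L i u) <= C * nrm u.
Proof.
apply: contrapT => nb.
have step (n : nat) (xr : X * R) : exists yd : X * R, 0 < xr.2 ->
    [/\ 0 < yd.2, yd.2 <= n.+1%:R^-1,
        forall z, nrm (z - yd.1) <= yd.2 -> nrm (z - xr.1) <= xr.2 &
        exists i, forall z, nrm (z - yd.1) <= yd.2 -> n%:R < nrm (L i z)].
  have [r0|r0] := ltP 0 xr.2; last by exists (0, 1).
  have [i [y [yr Ly]]] := @unbounded_on_ball xr.1 _ n%:R r0 nb.
  have [d d0 dL] : exists2 d : R, 0 < d &
      forall z, nrm (z - y) < d -> n%:R < nrm (L i z).
    have e0 : 0 < nrm (L i y) - n%:R by rewrite subr_gt0.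
    have /cvg_nrmP/cvgrPdist_lt/(_ _ e0) := @contL i y.
    move=> /nbhs_normP[d /= /gt0_complexE[dE d0] dF]; exists (complex.Re d) => //.
    move=> z zd; have := dF z; rewrite /ball_ /= => /(_ _)/wrap[].
      by rewrite distrC nrmE dE ltcR.
    rewrite sub0r normrN ger0_norm ?nrm_ge0// => h.
    have := le_lt_trans (ler_dist_nrm _ _) h.
    rewrite distrC => /(le_lt_trans (ler_norm _)).
    by rewrite ltrBlDr addrC -ltrBlDr opprB addrC subrK.
  (* d / 2 turns the open ball of continuity into a closed one, the second
     term keeps it inside the previous ball, the third makes centres Cauchy *)
  pose e := Num.min (d / 2) (Num.min (xr.2 - nrm (y - xr.1)) n.+1%:R^-1).
  have [e1 e2 e3] : [/\ e <= d / 2, e <= xr.2 - nrm (y - xr.1) & e <= n.+1%:R^-1].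
    by rewrite /e !ge_min !lexx !orbT.
  exists (y, e) => _ /=; split => //.
  - by rewrite /e !lt_min divr_gt0// subr_gt0 yr/= invr_gt0 ltr0n.
  - move=> z ze; rewrite (le_trans (nrm_distD y _ _))// -lerBrDr.
    exact: le_trans ze e2.
  - exists i => z ze; apply: dL; apply: le_lt_trans ze _; apply: le_lt_trans e1 _.
    by rewrite ltr_pdivrMr// ltr_pMr// ltr1n.
have /choice[f fP] : forall p : nat * (X * R), exists yd, _ := fun p => step p.1 p.2.
pose st := fix st n := if n is m.+1 then f (m, st m) else (0 : X, 1 : R).
have st0 n : 0 < (st n).2.
  by elim: n => [//|n IH]; have [] := fP (n, st n) IH.
have sub n m z : (n <= m)%N -> nrm (z - (st m).1) <= (st m).2 ->
    nrm (z - (st n).1) <= (st n).2.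
  move=> /subnK <-; elim: (m - n)%N => [//|k IH] zk; apply: IH.
  by have [_ _ + _] := fP ((k + n)%N, st (k + n)%N) (st0 _); apply.
have cen n m : (n <= m)%N -> nrm ((st m).1 - (st n).1) <= (st n).2.
  by move=> nm; apply: (sub n m) => //; rewrite subrr nrm0 ltW.
have [x stx] : exists x : X, (st n).1 @[n --> \oo] --> x.
  apply: nrm_cauchy_cvg => e e0.
  have [N _ /(_ N (leqnn N)) NP] : \forall n \near \oo, n.+1%:R^-1 < e / 2.
    have e20 : 0 < e / 2 by rewrite divr_gt0.
    have /cvgrPdist_lt/(_ _ e20) := @cvg_harmonic R; apply: filterS => n.
    by rewrite sub0r normrN ger0_norm// invr_ge0 ler0n.
  exists N.+1 => n m Nn Nm.
  rewrite (le_lt_trans (nrm_distD (st N.+1).1 _ _))// (splitr e) ltrD//.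
    apply: le_lt_trans NP; apply: le_trans (cen _ _ Nn) _.
    by have [] := fP (N, st N) (st0 _).
  apply: le_lt_trans NP; rewrite nrm_distC; apply: le_trans (cen _ _ Nm) _.
  by have [] := fP (N, st N) (st0 _).
have [K Kx] := ptbL x.
have [n Kn] : exists n : nat, K < n%:R.
  exists (Num.bound `|K|).
  by apply: le_lt_trans (ler_norm K) _; exact: archi_boundP.
have [_ _ _ [i iP]] := fP (n, st n) (st0 _).
have := iP x; rewrite ltNge (le_trans (Kx i) (ltW Kn)) => /(_ _)/wrap[]//.
have h : nrm ((st m).1 - (st n.+1).1) @[m --> \oo] --> nrm (x - (st n.+1).1).
  by apply: cvg_nrm; apply: cvgB => //; exact: cvg_cst.
apply: (@cvgr_to_le _ _ _ _ _ _ _ h); exists n.+1 => // m /= nm; exact: (cen n.+1 m).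
Qed.

End UniformBoundedness.

(** * Strongly continuous semigroups *)

(** Gives access to the algebra of linear maps for operators whose linearity
    is known only under a hypothesis, such as [S t] for [0 <= t]. *)
Definition pack_linear (R : realType) (X : completeNormedModType R[i])
    (L : X -> X) (linL : linear L) : {linear X -> X} :=
  HB.pack L (GRing.isLinear.Build _ _ _ _ L linL).

Section Semigroup.
Variables (R : realType) (X : completeNormedModType R[i]) (A : plin X X).
Variable S : R -> X -> X.
Hypothesis SA : semigroup_of A S.
Implicit Types (t r : R) (x : X).

Lemma semigroup0 x : S 0 x = x.
Proof. by have [] := SA. Qed.

Lemma semigroupD t r x : 0 <= t -> 0 <= r -> S (t + r) x = S t (S r x).
Proof. by have [_ + _ _ _] := SA; apply. Qed.

Lemma semigroup_linear t : 0 <= t -> linear (S t).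
Proof. by have [_ _ + _ _] := SA => /[apply] -[]. Qed.

Lemma semigroup_continuous t : 0 <= t -> continuous (S t).
Proof. by have [_ _ + _ _] := SA => /[apply] -[]. Qed.

Lemma semigroup_at0 x (e : R) : 0 < e ->
  exists2 d, 0 < d & forall t, 0 <= t < d -> nrm (S t x - x) < e.
Proof.
move=> e0; have [_ _ _ /(_ x) Sx _] := SA.
have /cvg_nrmP/cvgrPdist_lt/(_ _ e0) [d /= d0 dS] := Sx.
exists d => // t /andP[t0 td]; have [->|tn0] := eqVneq t 0.
  by rewrite semigroup0 subrr nrm0.
have tgt0 : 0 < t by rewrite lt_neqAle eq_sym tn0.
have := dS t; rewrite /= !sub0r !normrN !ger0_norm ?nrm_ge0//.
by apply.
Qed.

(** Otherwise there are times [t_n] tending to 0 at which [S] is not bounded by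
    [n + 1].  Along such a sequence [S t_n x] converges, hence stays bounded,
    for each [x], which contradicts uniform boundedness. *)
Lemma semigroup_bounded_near0 : exists d M : R, [/\ 0 < d, 1 <= M &
  forall t x, 0 <= t <= d -> nrm (S t x) <= M * nrm x].
Proof.
apply: contrapT => H.
have tn (n : nat) : exists tx : R * X, 0 <= tx.1 <= n.+1%:R^-1 /\
    n.+1%:R * nrm tx.2 < nrm (S tx.1 tx.2).
  apply: contrapT => Hn; apply: H; exists n.+1%:R^-1, n.+1%:R; split.
  - by rewrite invr_gt0 ltr0n.
  - by rewrite ler1n.
  - by move=> t x t0; rewrite leNgt; apply/negP => tx; apply: Hn; exists (t, x).
have [f fP] := choice tn.
have f0 n : 0 <= (f n).1 by have [/andP[]] := fP n.
pose L n := pack_linear (semigroup_linear (f0 n)).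
have ptw x : exists K, forall n, nrm (L n x) <= K.
  have [d d0 dS] := semigroup_at0 x ltr01.
  have [N _ NP] : \forall n \near \oo, n.+1%:R^-1 < d.
    have /cvgrPdist_lt/(_ _ d0) := @cvg_harmonic R; apply: filterS => n.
    by rewrite sub0r normrN ger0_norm// invr_ge0 ler0n.
  exists (\sum_(n < N) nrm (L n x) + (nrm x + 1)) => n.
  have s0 : 0 <= \sum_(n < N) nrm (L n x) by apply: sumr_ge0 => k _; exact: nrm_ge0.
  have [nN|Nn] := ltnP n N.
    rewrite (bigD1 (Ordinal nN))//= -addrA lerDl addr_ge0 ?addr_ge0 ?nrm_ge0//.
    by apply: sumr_ge0 => k _; exact: nrm_ge0.
  rewrite (le_trans _ (_ : nrm x + 1 <= _))// ?lerDr//.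
  rewrite -[X in nrm X <= _](subrK x) addrC (le_trans (nrmD _ _))// lerD2l ltW//.
  apply: dS; rewrite f0/=; have [/andP[_ fn] _] := fP n.
  by apply: le_lt_trans fn _; exact: NP.
have [|C C0 LC] := uniform_boundedness (L := L) _ ptw.
  by move=> n; exact: (semigroup_continuous (f0 n)).
have [n Cn] : exists n : nat, C < n%:R.
  by exists (Num.bound C); exact: archi_boundP.
have [_] := fP n; apply/negP; rewrite -leNgt (le_trans (LC n (f n).2))//.
rewrite ler_wpM2r ?nrm_ge0// (le_trans (ltW Cn))// ler_nat//.
Qed.

(** [[0, T]] is covered by finitely many steps of a length on which the
    semigroup is bounded, and bounds multiply along the semigroup law. *)
Lemma semigroup_bounded (T : R) : exists2 M, 1 <= M &
  forall t x, 0 <= t <= T -> nrm (S t x) <= M * nrm x.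
Proof.
have [d [M [d0 M1 MS]]] := semigroup_bounded_near0.
have MS' n : forall t x, 0 <= t <= n.+1%:R * d -> nrm (S t x) <= M ^+ n.+1 * nrm x.
  elim: n => [|n IH] t x /andP[t0 tn].
    by rewrite expr1 MS// t0 -[d]mul1r.
  have [td|dt] := leP t d.
    rewrite (le_trans (MS _ _ _)) ?t0// ler_wpM2r ?nrm_ge0//.
    by rewrite -[X in X <= _]expr1 ler_weXn2l.
  have td0 : 0 <= t - d by rewrite subr_ge0 ltW.
  rewrite -(subrK d t) addrC semigroupD// ?(ltW d0)//.
  rewrite (le_trans (MS _ _ _)) ?lexx ?(ltW d0)// exprS -mulrA.
  rewrite ler_wpM2l ?(le_trans ler01)//; apply: IH.
  by rewrite td0/= lerBlDr -[X in _ + X]mul1r -mulrDl natr1.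
have [n Tn] : exists n : nat, T / d < n%:R.
  exists (Num.bound `|T / d|).
  by apply: le_lt_trans (ler_norm (T / d)) _; exact: archi_boundP.
exists (M ^+ n.+1); first by rewrite exprn_ege1.
move=> t x /andP[t0 tT]; apply: MS'; rewrite t0 (le_trans tT)//.
rewrite -ler_pdivrMr// (le_trans (ltW Tn))// ler_nat//.
Qed.

(** For [r <= t], the difference is [S r] applied to [S (t - r) x - x]: this
    turns right continuity at 0 into uniform continuity on [[0, T]]. *)
Lemma semigroup_unif_continuous (T : R) x (e : R) : 0 < e ->
  exists2 d, 0 < d & forall r t, 0 <= r <= T -> 0 <= t <= T -> `|t - r| < d ->
    nrm (S t x - S r x) < e.
Proof.
move=> e0; have [M M1 MS] := semigroup_bounded T.
have M0 : 0 < M by exact: lt_le_trans M1.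
have [d d0 dS] := semigroup_at0 x (divr_gt0 e0 M0).
exists d => // r t; wlog rt : r t / r <= t => [hw r0 t0 tr|].
  have [rt|/ltW tr'] := leP r t; first exact: hw.
  by rewrite nrm_distC hw// distrC.
move=> /andP[r0 rT] /andP[t0 tT] tr.
have tr0 : 0 <= t - r by rewrite subr_ge0.
have -> : S t x = S r (S (t - r) x) by rewrite -semigroupD// addrC subrK.
have -> : S r (S (t - r) x) - S r x = S r (S (t - r) x - x).
  by rewrite -[S r]/(pack_linear (semigroup_linear r0) : X -> X) linearB.
apply: le_lt_trans (MS _ _ _) _; first by rewrite r0.
rewrite -ltr_pdivlMl// mulrC dS// tr0.
by move: tr; rewrite ger0_norm.
Qed.

Lemma convolution_continuous (T a b t : R) (G : R -> X) : b <= t -> t - a <= T ->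
  {within `[a, b], continuous G} ->
  {within `[a, b], continuous (fun xi => S (t - xi) (G xi))}.
Proof.
move=> bt taT /within_continuous_nrmP cG; apply/within_continuous_nrmP.
move=> xi xiab e e0; have [M M1 MS] := semigroup_bounded T.
have M0 : 0 < M by exact: lt_le_trans M1.
have tT r : a <= r <= b -> 0 <= t - r <= T.
  move=> /andP[ar rb]; rewrite subr_ge0 (le_trans rb bt) (le_trans _ taT)//.
  by rewrite lerD2l lerN2.
have e20 : 0 < e / 2 by rewrite divr_gt0.
have [d1 d10 d1S] := semigroup_unif_continuous T (G xi) e20.
have [d2 d20 d2G] := cG _ xiab _ (divr_gt0 e20 M0).
exists (Num.min d1 d2); first by rewrite lt_min d10.
move=> r rab; rewrite lt_min => /andP[rd1 rd2].
have tr0 : 0 <= t - r by have /andP[] := tT r rab.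
apply: le_lt_trans (nrm_distD (S (t - r) (G xi)) _ _) _.
rewrite (splitr e) ltrD//.
  have -> : S (t - r) (G r) - S (t - r) (G xi) = S (t - r) (G r - G xi).
    by rewrite -[S _]/(pack_linear (semigroup_linear tr0) : X -> X) linearB.
  apply: le_lt_trans (MS _ _ (tT r rab)) _.
  by rewrite -ltr_pdivlMl// mulrC d2G.
apply: d1S; [exact: tT|exact: tT|].
by rewrite opprB addrC addrA subrK.
Qed.

End Semigroup.

(** * Taylor expansion with an integrable derivative *)

Section NormIntegral.
Variables (R : realType) (X : completeNormedModType R[i]) (T : R) (h : R -> X).
Hypothesis hI : bochner_integrable 0 T h.
Local Notation mu := (@lebesgue_measure R).

Definition nrm_int (F : R -> X) (a b : R) : R := \int[mu]_(t in `[a, b]) nrm (F t).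

Lemma measurable_nrm_sub (a b : R) : 0 <= a -> b <= T ->
  measurable_fun `[a, b] (fun t => (nrm (h t))%:E).
Proof.
move=> a0 bT; have [v /is_bochnerP[p /(approximates_sub a0 bT) pF _]] := hI.
by apply/measurable_EFinP; exact: measurable_nrm pF.
Qed.

Lemma nrm_intE (a b : R) : 0 <= a -> b <= T ->
  (nrm_int h a b)%:E = (\int[mu]_(t in `[a, b]) (nrm (h t))%:E)%E.
Proof.
move=> a0 bT; rewrite /nrm_int /Rintegral fineK// ge0_fin_numE.
  have [v hv] := bochner_integrable_sub a0 bT hI; exact: is_bochner_int_lty hv.
by apply: integral_ge0 => t _; rewrite lee_fin nrm_ge0.
Qed.

Lemma nrm_int_ge0 (a b : R) : 0 <= nrm_int h a b.
Proof. by apply: Rintegral_ge0 => t _; exact: nrm_ge0. Qed.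

Lemma nrm_int_sub (a b a' b' : R) : 0 <= a -> b <= T -> a <= a' -> b' <= b ->
  nrm_int h a' b' <= nrm_int h a b.
Proof.
move=> a0 bT aa' bb'; rewrite -lee_fin !nrm_intE ?(le_trans a0)// ?(le_trans bb')//.
apply: ge0_subset_integral => //; first exact: measurable_nrm_sub.
  by move=> t _; rewrite lee_fin nrm_ge0.
by apply: subset_itv; rewrite bnd_simp.
Qed.

Lemma nrm_int_split (a b c : R) : 0 <= a -> b <= T -> a <= c <= b ->
  nrm_int h a b = nrm_int h a c + nrm_int h c b.
Proof.
move=> a0 bT /andP[ac cb]; apply: EFin_inj.
rewrite EFinD !nrm_intE ?(le_trans a0)// ?(le_trans cb)//.
have mab := measurable_nrm_sub a0 bT.
have abE : [set` `[a, b]] = [set` `[a, c]] `|` [set` `]c, b]].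
  by rewrite -itv_bndbnd_setU// ?bnd_simp.
rewrite -[X in (_ = _ + X)%E]integral_itv_obnd_cbnd; last first.
  by apply: measurable_funS mab => //; apply: subset_itv; rewrite bnd_simp.
rewrite -ge0_integral_setU//=; first by rewrite -abE.
- by rewrite -abE.
- by move=> t _; rewrite lee_fin nrm_ge0.
- apply/disj_setPS => t /= []; rewrite !in_itv/= => /andP[_ tc] /andP[ct _].
  by move: (lt_le_trans ct tc); rewrite ltxx.
Qed.

Lemma nrm_bochner_le_int (a b : R) : 0 <= a -> b <= T ->
  nrm (bochner a b h) <= nrm_int h a b.
Proof.
move=> a0 bT; rewrite -lee_fin nrm_intE//; apply: nrm_is_bochner.
by apply: bochnerP; exact: bochner_integrable_sub hI.
Qed.

Lemma primitive_nrm_le (g : R -> X) :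
  (forall t, 0 <= t <= T -> g t = g 0 + bochner 0 t h) ->
  forall r t, 0 <= r -> r <= t -> t <= T ->
    g t - g r = bochner r t h /\ nrm (g t - g r) <= nrm_int h r t.
Proof.
move=> gh r t r0 rt tT; have t0 := le_trans r0 rt.
have e : g t - g r = bochner r t h.
  rewrite (gh t) ?t0// (gh r) ?r0 ?(le_trans rt)//.
  rewrite (@bochner_split _ _ 0 t r) ?r0//; last exact: bochner_integrable_sub hI.
  by rewrite opprD addrACA subrr add0r addrC addKr.
by split => //; rewrite e nrm_bochner_le_int.
Qed.

(** Absolute continuity of the integral: up to [e / 2] in mean, the integrand is
    a simple function, and that is bounded. *)
Lemma nrm_int_small (e : R) : 0 < e -> exists2 d, 0 < d &
  forall a b, 0 <= a -> a <= b -> b <= T -> b - a < d -> nrm_int h a b < e.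
Proof.
move=> e0; have e20 : 0 < e / 2 by rewrite divr_gt0.
have [v /is_bochnerP[p pF _]] := hI; have [mp pFc p0] := pF.
have [N _ /(_ N (leqnn N))/= pN] := cvge0_near_lt p0 e20.
have [K K0 pK] := nrm_simple_fun_bounded (p N).
have K1 : 0 < K + 1 by rewrite ltr_wpDl.
exists (e / 2 / (K + 1)); first by rewrite divr_gt0.
move=> a b a0 ab bT abd.
have [mp' pFc' _] := approximates_sub a0 bT pF.
rewrite -lte_fin nrm_intE//.
have mab := measurable_nrm_subr mp pFc' (mp N).
apply: (@le_lt_trans _ _ (\int[mu]_(t in `[a, b]) (nrm (h t - simple_fun (p N) t))%:E +
  \int[mu]_(t in `[a, b]) K%:E)%E).
  apply: le_integralD => //; try by move=> t _; exact: nrm_ge0.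
  - by apply/measurable_EFinP; exact: measurable_nrm_sub.
  - move=> t _; rewrite -[X in nrm X <= _](subrK (simple_fun (p N) t)).
    by rewrite (le_trans (nrmD _ _))// lerD.
rewrite (splitr e) EFinD; apply: lte_leD => //.
- rewrite integral_cst//; apply: fin_numM => //.
  by rewrite ge0_fin_numE//; exact: lebesgue_itvcc_lty.
- apply: le_lt_trans pN; apply: ge0_subset_integral => //.
  + by apply/measurable_EFinP; exact: (measurable_nrm_subr mp pFc).
  + by move=> t _; rewrite lee_fin nrm_ge0.
  + by apply: subset_itv; rewrite bnd_simp.
- have -> : (\int[mu]_(t in `[a, b]) K%:E = (K * (b - a))%:E)%E.
    by rewrite integral_cst// EFinM; congr (_ * _)%E; exact: lebesgue_itvcc.
  rewrite lee_fin (le_trans (ler_wpM2l K0 (ltW abd)))//.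
  rewrite mulrC mulrAC ler_pdivrMr// ler_wpM2l ?(ltW e20)// lerDl ler01//.
Qed.

Lemma primitive_continuous (g : R -> X) :
  (forall t, 0 <= t <= T -> g t = g 0 + bochner 0 t h) ->
  {within `[0, T], continuous g}.
Proof.
move=> gh; apply/within_continuous_nrmP => t /andP[t0 tT] e e0.
have [d d0 dh] := nrm_int_small e0; exists d => // r /andP[r0 rT] trd.
wlog rt : r t r0 rT t0 tT trd / t <= r => [hw|].
  have [tr|/ltW rt] := leP t r; first exact: hw.
  by rewrite nrm_distC hw// distrC.
have [_ /le_lt_trans] := primitive_nrm_le gh t0 rt rT; apply; apply: dh => //.
by move: trd; rewrite distrC ger0_norm ?subr_ge0.
Qed.

End NormIntegral.

Section Taylor.
Variables (R : realType) (X : completeNormedModType R[i]) (T : R).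

(** In an expansion, the coefficients [G] are the derivatives at the expansion
    point; only their existence enters, since the quadrature is exact for
    every choice. *)
Definition taylor_poly (s : nat) (G : nat -> X) (t : R) : X :=
  \sum_(j < s) (t ^+ j / j`!%:R)%:C *: G j.

Lemma is_bochner_taylor_poly s (G : nat -> X) (x : R) : 0 <= x ->
  is_bochner 0 x (taylor_poly s G)
    (\sum_(j < s) (x ^+ j.+1 / j.+1`!%:R)%:C *: G j).
Proof.
by move=> x0; apply: is_bochner_sum => j; exact: is_bochner_monomial.
Qed.

Lemma L1_deriv_integrable s (g h : R -> X) : L1_deriv s.+1 T g h ->
  bochner_integrable 0 T h.
Proof.
elim: s g => [|s IH] g [g1 [[v g1v] _]]; last exact: IH.
by move=> g1h; exists v; exact: is_bochner_ext g1v.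
Qed.

Lemma L1_deriv_continuous s (g h : R -> X) : L1_deriv s.+1 T g h ->
  {within `[0, T], continuous g}.
Proof. by move=> [g1 [g1I gg1 _]]; exact: primitive_continuous gg1. Qed.

(** Induction on the order.  Integrating the expansion of the derivative raises
    the degree of the polynomial by one and costs a factor [x]; the monotone
    factor [nrm_int h a (a + x)] is carried along, so the iterated integral of
    the exact remainder formula never appears. *)
Lemma taylor_remainder s (g h : R -> X) (a : R) : L1_deriv s.+1 T g h -> 0 <= a ->
  exists G : nat -> X, forall x, 0 <= x -> a + x <= T ->
    nrm (g (a + x) - taylor_poly s.+1 G x) <= x ^+ s * nrm_int h a (a + x).
Proof.
move=> gh a0; elim: s g gh => [|s IH] g gh.
  exists (fun=> g a) => x x0 axT; rewrite expr0 mul1r.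
  rewrite /taylor_poly big_ord1 expr0 fact0 divr1 scale1r.
  have [g1 [g1I gg1 g1h]] := gh.
  have [|_] := primitive_nrm_le g1I gg1 a0 _ axT; first by rewrite lerDl.
  congr (_ <= _); apply: eq_Rintegral => t; rewrite inE/= in_itv/= => /andP[at_ ta].
  by rewrite g1h// (le_trans a0 at_) (le_trans ta axT).
have hI := L1_deriv_integrable gh.
have [g1 [g1I gg1 g1h]] := gh; have [G1 G1P] := IH g1 g1h.
exists (fun j => if j is j'.+1 then G1 j' else g a) => x x0 axT.
have aax : a <= a + x by rewrite lerDl.
have [gE _] := primitive_nrm_le g1I gg1 a0 aax axT.
rewrite /taylor_poly big_ord_recl/= expr0 fact0 divr1 scale1r opprD addrA gE.
have cg1 : {within `[0 + a, x + a], continuous g1}.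
  by rewrite add0r addrC; exact: within_continuous_sub (L1_deriv_continuous g1h).
rewrite -{1}(add0r a) (addrC a x) bochner_shift//.
have [v g1v] := continuous_bochner x0 (within_continuous_shift cg1).
rewrite (bochner_eq g1v).
have H := nrm_is_bochner_le (K := x ^+ s * nrm_int h a (a + x)) x0
  (is_bochnerB g1v (is_bochner_taylor_poly s.+1 G1 x0)).
rewrite exprSr mulrAC -[X in _ <= _ * X]subr0 (addrC x a); apply: H => t /andP[t0 tx].
rewrite (addrC t a) (le_trans (G1P t t0 _)) ?(le_trans _ axT) ?lerD2l//.
apply: ler_pM; rewrite ?exprn_ge0 ?nrm_int_ge0// ?lerXn2r ?nnegrE//.
by apply: (nrm_int_sub hI) => //; rewrite lerD2l.
Qed.

End Taylor.

(** * Exponential quadrature *)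

Section Quadrature.
Variables (R : realType) (X : completeNormedModType R[i]) (A : plin X X).
Variable S : R -> X -> X.
Hypothesis SA : semigroup_of A S.
Variables (T M : R).
Hypotheses (M1 : 1 <= M)
  (MS : forall t x, 0 <= t <= T -> nrm (S t x) <= M * nrm x).

(** The definition of [phi] without its division by [tau ^+ j.+1]: the monomial
    is moved inside [S], which exhibits the integral as one of the form that
    occurs in the variation-of-constants formula. *)
Lemma phi_is_bochner j (tau : R) x : 0 < tau -> tau <= T ->
  is_bochner 0 tau (fun xi => S (tau - xi) ((xi ^+ j / j`!%:R)%:C *: x))
    ((tau ^+ j.+1)%:C *: phi S j tau x).
Proof.
move=> tau0 tauT; have tau0' := ltW tau0.
have cF : {within `[0, tau], continuous (fun xi => (xi ^+ j / j`!%:R)%:C *: x)}.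
  apply: within_continuousZ; last by apply/subspace_continuousP => t _; exact: cvg_cst.
  by move=> t; apply: cvgM; [exact: exprn_continuous|exact: cvg_cst].
have tT : tau - 0 <= T by rewrite subr0.
have Fv := bochnerP (continuous_bochner tau0'
  (convolution_continuous SA (lexx tau) tT cF)).
move: (Fv); congr is_bochner.
rewrite /phi scalerA -rmorphM /= mulfV ?scale1r ?expf_neq0 ?gt_eqF//.
apply: esym; apply: bochner_eq; apply: is_bochner_ext Fv => t /andP[t0 tt].
have st0 : 0 <= tau - t by rewrite subr_ge0.
by rewrite -[S _]/(pack_linear (semigroup_linear SA st0) : X -> X) linearZ.
Qed.

(** The integrand is at most [tau ^+ j * M * nrm x] on an interval of length
    [tau], which the normalization by [tau ^+ j.+1] compensates: the bound does
    not depend on the step size. *)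
Lemma nrm_phi_le j (tau : R) x : 0 < tau -> tau <= T ->
  nrm (phi S j tau x) <= M * nrm x.
Proof.
move=> tau0 tauT; have tau0' := ltW tau0; have M0 : 0 <= M := le_trans ler01 M1.
have := nrm_is_bochner_le (K := tau ^+ j * (M * nrm x)) tau0'
  (phi_is_bochner j x tau0 tauT).
rewrite nrmZ subr0 ger0_norm ?exprn_ge0// mulrAC -exprSr ler_pM2l ?exprn_gt0//.
apply => t /andP[t0 tt]; apply: le_trans (MS _ _) _.
  by rewrite subr_ge0 tt (le_trans _ tauT)// gerBl.
rewrite nrmZ mulrCA ler_wpM2r ?mulr_ge0 ?nrm_ge0//.
rewrite ger0_norm ?divr_ge0 ?exprn_ge0// ler_pdivrMr ?ltr0n ?fact_gt0//.
apply: (@le_trans _ _ (tau ^+ j * 1)); last first.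
  by rewrite ler_wpM2l ?exprn_ge0// ler1n fact_gt0.
by rewrite mulr1 lerXn2r ?nnegrE.
Qed.

Lemma phi_linear j (tau : R) : 0 < tau -> tau <= T -> linear (phi S j tau).
Proof.
move=> tau0 tauT k x y.
have tn : (tau ^+ j.+1)%:C != 0 by rewrite fmorph_eq0 expf_neq0// gt_eqF.
apply: (scalerI tn).
rewrite [RHS]scalerDr [in RHS]scalerA [in RHS](mulrC (tau ^+ j.+1)%:C) -[in RHS]scalerA.
apply: (is_bochner_unique (phi_is_bochner j (k *: x + y) tau0 tauT)).
have := is_bochnerD (is_bochnerZ k (phi_is_bochner j x tau0 tauT))
  (phi_is_bochner j y tau0 tauT).
apply: is_bochner_ext => t /andP[t0 tt].
have st0 : 0 <= tau - t by rewrite subr_ge0.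
rewrite -[S _]/(pack_linear (semigroup_linear SA st0) : X -> X).
by rewrite -linearZ -linearD scalerDr !scalerA mulrC.
Qed.

Variables (s : nat) (c : 'I_s -> R) (b : 'I_s -> R -> X -> X).
Hypothesis hb : quadrature_weights S c b.

Lemma weight_linear i (tau : R) : 0 < tau -> tau <= T -> linear (b i tau).
Proof.
move=> tau0 tauT k x y; have [[beta bE] _] := hb.
rewrite !bE// scaler_sumr -big_split/=; apply: eq_bigr => j _.
rewrite (phi_linear j tau0 tauT); move: (phi S j tau x) (phi S j tau y) => u v.
by rewrite scalerDr !scalerA mulrC.
Qed.

(** The coefficients of the weights over the [phi] functions do not depend on
    the step size, so the bound on those is inherited. *)
Lemma weight_bounded : exists2 B : R, 0 <= B & forall tau (r : 'I_s -> X) (K : R),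
  0 < tau -> tau <= T -> (forall i, nrm (r i) <= K) ->
  nrm (\sum_i b i tau (r i)) <= B * K.
Proof.
have [[beta bE] _] := hb; have M0 : 0 <= M := le_trans ler01 M1.
have beta0 i j : 0 <= complex.Re `|beta i j|.
  have : 0 <= `|beta i j| by [].
  by rewrite lecE => /andP[].
exists (\sum_i \sum_j complex.Re `|beta i j| * M).
  by apply: sumr_ge0 => i _; apply: sumr_ge0 => j _; exact: mulr_ge0.
move=> tau r K tau0 tauT rK; apply: le_trans (nrm_sum _ _ _) _.
rewrite mulr_suml; apply: ler_sum => i _.
rewrite bE// mulr_suml; apply: le_trans (nrm_sum _ _ _) _.
apply: ler_sum => j _; rewrite nrmZc -mulrA ler_wpM2l//.
by apply: le_trans (nrm_phi_le j (r i) tau0 tauT) _; rewrite ler_wpM2l.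
Qed.

(** The order conditions are precisely exactness on the monomials of degree less
    than [s]; the power of [tau] left over for each degree is the one in
    [phi_is_bochner]. *)
Lemma quadrature_exact (G : nat -> X) (tau : R) : 0 < tau -> tau <= T ->
  is_bochner 0 tau (fun xi => S (tau - xi) (taylor_poly s G xi))
    (tau%:C *: \sum_i b i tau (taylor_poly s G (c i * tau))).
Proof.
move=> tau0 tauT; have [_ ordc] := hb.
have := is_bochner_sum (fun j : 'I_s => phi_is_bochner j (G j) tau0 tauT).
have -> : \sum_(j < s) (tau ^+ j.+1)%:C *: phi S j tau (G j) =
  tau%:C *: \sum_i b i tau (taylor_poly s G (c i * tau)).
  have bP i : b i tau (taylor_poly s G (c i * tau)) =
      \sum_(j < s) ((c i * tau) ^+ j / j`!%:R)%:C *: b i tau (G j).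
    rewrite -[b i tau]/(pack_linear (weight_linear i tau0 tauT) : X -> X).
    by rewrite linear_sum; apply: eq_bigr => j _; rewrite linearZ.
  under [in RHS]eq_bigr => i _ do rewrite bP.
  rewrite exchange_big scaler_sumr; apply: eq_bigr => j _ /=.
  rewrite -ordc// !scaler_sumr; apply: eq_bigr => i _.
  rewrite !scalerA -!rmorphM /=; congr ((_)%:C *: _).
  by rewrite exprMn exprS; ring.
apply: is_bochner_ext => t /andP[t0 tt].
have st0 : 0 <= tau - t by rewrite subr_ge0.
by rewrite -[S _]/(pack_linear (semigroup_linear SA st0) : X -> X) linear_sum.
Qed.

End Quadrature.

(** * Convergence of the method *)

(** Exactness removes the Taylor polynomial of [g] at [t] from both terms.  What
    remains is the difference of an integral and a quadrature of the remainder,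
    each bounded by the size of the remainder, [tau ^+ s] times the integral of
    [|h|], times the step size. *)
Lemma quadrature_error (R : realType) (X : completeNormedModType R[i])
    (A : plin X X) (S : R -> X -> X) (s : nat) (c : 'I_s.+1 -> R)
    (b : 'I_s.+1 -> R -> X -> X) (T : R) :
  semigroup_of A S -> (forall i, 0 <= c i <= 1) -> quadrature_weights S c b ->
  exists2 C : R, 0 <= C & forall g h : R -> X, L1_deriv s.+1 T g h ->
    forall t tau, 0 <= t -> 0 < tau -> t + tau <= T ->
    nrm (bochner 0 tau (fun xi => S (tau - xi) (g (t + xi))) -
         tau%:C *: \sum_i b i tau (g (t + c i * tau)))
    <= C * (tau ^+ s.+1 * nrm_int h t (t + tau)).
Proof.
move=> SA hc hb; have [M M1 MS] := semigroup_bounded SA T.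
have M0 : 0 <= M := le_trans ler01 M1.
have [B B0 bB] := weight_bounded SA M1 MS hb.
exists (M + B); first exact: addr_ge0.
move=> g h gh t tau t0 tau0 tT.
have tau0' := ltW tau0; have tauT : tau <= T by rewrite (le_trans _ tT)// lerDr.
have [G GP] := taylor_remainder gh t0.
pose r xi := g (t + xi) - taylor_poly s.+1 G xi.
pose rho := tau ^+ s * nrm_int h t (t + tau).
have rB xi : 0 <= xi <= tau -> nrm (r xi) <= rho.
  move=> /andP[x0 xt]; have txT : t + xi <= T by rewrite (le_trans _ tT)// lerD2l.
  apply: le_trans (GP xi x0 txT) _; apply: ler_pM.
  - exact: exprn_ge0.
  - exact: nrm_int_ge0.
  - by rewrite lerXn2r ?nnegrE.
  - by apply: (nrm_int_sub (L1_deriv_integrable gh)) => //; rewrite lerD2l.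
have cg : {within `[0, tau], continuous (fun xi => g (t + xi))}.
  have -> : (fun xi => g (t + xi)) = (fun xi => g (xi + t)).
    by apply/funext => xi; rewrite addrC.
  apply: within_continuous_shift; rewrite add0r addrC.
  exact: within_continuous_sub (L1_deriv_continuous gh).
have tT0 : tau - 0 <= T by rewrite subr0.
have Ig := bochnerP (continuous_bochner tau0'
  (convolution_continuous SA (lexx tau) tT0 cg)).
have Iexact := quadrature_exact SA hb G tau0 tauT.
have Ir := is_bochnerB Ig Iexact.
have ci i : 0 <= c i * tau <= tau.
  by have /andP[c0 c1] := hc i; rewrite mulr_ge0//= ler_piMl.
have splitb : \sum_i b i tau (g (t + c i * tau)) =
    \sum_i b i tau (taylor_poly s.+1 G (c i * tau)) + \sum_i b i tau (r (c i * tau)).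
  rewrite -big_split; apply: eq_bigr => i _ /=.
  have -> : g (t + c i * tau) = taylor_poly s.+1 G (c i * tau) + r (c i * tau).
    by rewrite [RHS]addrC subrK.
  exact: (linearD (pack_linear (weight_linear SA hb i tau0 tauT))).
rewrite splitb scalerDr opprD addrA.
apply: le_trans (nrmB _ _) _.
have -> : (M + B) * (tau ^+ s.+1 * nrm_int h t (t + tau)) =
    M * rho * (tau - 0) + tau * (B * rho) by rewrite /rho exprS; ring.
apply: lerD; last first.
  rewrite nrmZ ger0_norm// ler_wpM2l//; apply: bB => // i; exact: rB.
apply: (nrm_is_bochner_le tau0' Ir) => xi /andP[x0 xt].
have tx0 : 0 <= tau - xi by rewrite subr_ge0.
rewrite -[S _]/(pack_linear (semigroup_linear SA tx0) : X -> X) -linearB /=.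
apply: le_trans (MS _ _ _) _; last by rewrite ler_wpM2l// rB ?x0.
by rewrite tx0 (le_trans _ tauT)// gerBl.
Qed.

(** The variation-of-constants formula may be restarted at any time: [S tau] is
    pulled into the integral up to [t], and the rest is shifted to [[0, tau]]. *)
Lemma mild_solution_step (R : realType) (X : completeNormedModType R[i])
    (A : plin X X) (S : R -> X -> X) (T : R) (g w : R -> X) :
  semigroup_of A S -> {within `[0, T], continuous g} ->
  (forall t, 0 <= t <= T ->
     w t = S t (w 0) + bochner 0 t (fun xi => S (t - xi) (g xi))) ->
  forall t tau, 0 <= t -> 0 <= tau -> t + tau <= T ->
    w (t + tau) =
    S tau (w t) + bochner 0 tau (fun xi => S (tau - xi) (g (t + xi))).
Proof.
move=> SA cg wE t tau t0 tau0 tT.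
have tT' : t <= T by rewrite (le_trans _ tT)// lerDl.
have ttau0 : 0 <= t + tau by exact: addr_ge0.
have Slin := semigroup_linear SA tau0.
have conv r a b : b <= r -> r - a <= T -> 0 <= a -> b <= T ->
    {within `[a, b], continuous (fun xi => S (r - xi) (g xi))}.
  move=> br raT a0 bT; apply: (convolution_continuous SA br raT).
  exact: within_continuous_sub cg.
have SD x y : S tau (x + y) = S tau x + S tau y by exact: (linearD (pack_linear Slin)).
have ttauT : 0 <= t + tau <= T by rewrite ttau0.
have tT0 : 0 <= t <= T by rewrite t0.
rewrite (wE _ ttauT) (wE _ tT0) SD.
have [M M1 MS] := semigroup_bounded SA T.
have I0 : bochner_integrable 0 (t + tau) (fun xi => S (t + tau - xi) (g xi)).
  by apply: continuous_bochner => //; apply: conv => //; rewrite subr0.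
rewrite (@bochner_split _ _ 0 (t + tau) t)// ?t0 ?lerDl//.
rewrite -(semigroupD SA)// (addrC tau t) addrA; congr (_ + _ + _).
  apply: bochner_eq.
  have It : bochner_integrable 0 t (fun xi => S (t - xi) (g xi)).
    by apply: continuous_bochner => //; apply: conv => //; rewrite subr0.
  have tauT : 0 <= tau <= T by rewrite tau0 (le_trans _ tT)// lerDr.
  have := is_bochner_linear (L := pack_linear Slin) (K := M) (fun x => MS tau x tauT)
    (bochnerP It).
  apply: is_bochner_ext => xi /andP[x0 xt] /=.
  by rewrite -(semigroupD SA) ?subr_ge0// addrA (addrC tau t).
have := @bochner_shift R X 0 tau t (fun xi => S (t + tau - xi) (g xi)) tau0.
rewrite add0r (addrC tau t) => ->; last first.
  by apply: conv => //; rewrite addrAC subrr add0r (le_trans _ tT)// lerDr.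
congr bochner; apply/funext => xi; rewrite (addrC xi t).
by rewrite opprD addrACA subrr add0r.
Qed.

Section Grid.
Variables (R : realType) (T : R) (N : nat) (tau : nat -> R).
Hypothesis gT : grid T N tau.

Lemma nodeS n : node tau n.+1 = node tau n + tau n.
Proof. by rewrite /node big_ord_recr. Qed.

Lemma node0 : node tau 0 = 0.
Proof. by rewrite /node big_ord0. Qed.

Lemma node_le m n : (m <= n)%N -> (n <= N)%N -> node tau m <= node tau n.
Proof.
elim: n => [|n IH]; first by rewrite leqn0 => /eqP->.
rewrite leq_eqVlt ltnS => /orP[/eqP-> //|mn] nN.
by rewrite nodeS (le_trans (IH mn (ltnW nN)))// lerDl ltW// gT.1.
Qed.

Lemma node_ge0 n : (n <= N)%N -> 0 <= node tau n.
Proof. by move=> nN; rewrite -node0 node_le. Qed.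

Lemma node_leT n : (n <= N)%N -> node tau n <= T.
Proof. by move=> nN; rewrite -gT.2 node_le. Qed.

Lemma nrm_int_grid (X : completeNormedModType R[i]) (h : R -> X) n :
  bochner_integrable 0 T h -> (n <= N)%N ->
  \sum_(j < n) nrm_int h (node tau j) (node tau j.+1) = nrm_int h 0 (node tau n).
Proof.
move=> hI; elim: n => [|n IH] nN.
  by rewrite big_ord0 node0 /nrm_int set_itv1 Rintegral_set1.
rewrite big_ord_recr/= IH ?(ltnW nN)//; apply: esym.
apply: (nrm_int_split hI) => //; first exact: node_leT.
by rewrite node_ge0 ?node_le// ltnW.
Qed.

End Grid.

Theorem theorem1 (R : realType) (d m : nat) (Om : set 'rV[R]_d)
    (X : completeNormedModType R[i]) (incl : {linear X -> funs Om})
    (D : plin (funs Om) (funs Om)) (B : plin (funs Om) (bdata m Om))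
    (A : plin X X) (S : R -> X -> X)
    (s : nat) (c : 'I_s -> R) (bw : 'I_s -> R -> X -> X) (T : R)
    (hOm : is_domain Om) (hincl : injective incl)
    (hD : elliptic_operator m D) (hB : boundary_operator B)
    (hA : restricted_operator incl D B A) (hsect : sectorial A)
    (hS : semigroup_of A S)
    (hs : (0 < s)%N) (hc : forall i, 0 <= c i <= 1) (hcinj : injective c)
    (hbw : quadrature_weights S c bw) (hT : 0 < T) :
  exists C : R,
    forall (f : R -> funs Om) (b : R -> bdata m Om)
      (z : R -> 'rV[R]_d -> R[i]) (u0 : funs Om) (u : R -> funs Om)
      (g h : R -> X),
    correction B T b z ->
    (forall t, 0 <= t <= T -> incl (g t) = f t + correction_rhs D z t) ->
    L1_deriv s T g h ->
    exact_solution incl S T z g u0 u ->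
    (exists K : R, forall N tau U taumax,
       grid T N tau -> method incl S c bw z g u0 N tau U ->
       (forall j, (j < N)%N -> tau j <= taumax) ->
       forall n, (n <= N)%N ->
         norm_le incl (u (node tau n) - U n) (K * taumax ^+ s)) /\
    (forall N tau U,
       grid T N tau -> method incl S c bw z g u0 N tau U ->
       forall n, (n <= N)%N ->
         norm_le incl (u (node tau n) - U n)
           (C * \sum_(j < n) tau j ^+ s *
              \int[lebesgue_measure]_(t in `[node tau j, node tau j.+1])
                 nrm (h t))).
Proof.
case: s hs c bw hc hcinj hbw => [//|s] _ c bw hc _ hbw.
have [M M1 MS] := semigroup_bounded hS T; have M0 : 0 <= M := le_trans ler01 M1.
have [C0 C00 quadE] := quadrature_error T hS hc hbw.
exists (M * C0) => f b z u0 u g h _ _ gh [uu0 [w wP]].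
have hI := L1_deriv_integrable gh.
have wstep := mild_solution_step hS (L1_deriv_continuous gh) (fun t tT => (wP t tT).2).
(* Bounding all propagated errors [S r e], not just [e] itself, keeps the
   constant [M] from being raised to a power at each step. *)
have stab N tau U : grid T N tau -> method incl S c bw z g u0 N tau U ->
  forall n, (n <= N)%N -> exists2 e : X, incl e = u (node tau n) - U n &
    forall r, 0 <= r -> node tau n + r <= T -> nrm (S r e) <=
      M * C0 * \sum_(j < n) tau j ^+ s.+1 * nrm_int h (node tau j) (node tau j.+1).
  move=> gT [U0 UP]; elim=> [|n IH] nN.
    exists 0; first by rewrite linear0 node0 uu0 U0 subrr.
    move=> r r0 _; have := linear0 (pack_linear (semigroup_linear hS r0)).
    by rewrite /= => ->; rewrite nrm0 big_ord0 mulr0.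
  have [e eE eB] := IH (ltnW nN); have [v vE UE] := UP n nN.
  have tn0 := node_ge0 gT (ltnW nN); have tnT := node_leT gT (ltnW nN).
  have tSn0 := node_ge0 gT nN; have tSnT := node_leT gT nN.
  have taun0 : 0 < tau n by exact: gT.1.
  have Slin := semigroup_linear hS (ltW taun0).
  have wn : w (node tau n) = e + v.
    apply: hincl; rewrite linearD eE vE (wP _ _).1 ?tn0//.
    by rewrite addrA subrK.
  rewrite nodeS in tSnT tSn0.
  have wn1 := wstep _ _ tn0 (ltW taun0) tSnT.
  have SD x y : S (tau n) (x + y) = S (tau n) x + S (tau n) y.
    exact: (linearD (pack_linear Slin)).
  rewrite wn SD in wn1.
  set I := bochner _ _ _ in wn1.
  set Q := (tau n)%:C *: \sum_i bw i (tau n) (g (node tau n + c i * tau n)) in UE.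
  exists (S (tau n) e + (I - Q)).
    have := (wP (node tau n + tau n) _).1; rewrite tSn0 => /(_ tSnT).
    rewrite wn1 !linearD => wE; rewrite UE nodeS linearN.
    have -> : u (node tau n + tau n) =
        incl (S (tau n) e) + incl (S (tau n) v) + incl I +
        restr Om (z (node tau n + tau n)) by rewrite wE subrK.
    rewrite [X in X + _ - _]addrAC -[X in X - _]addrA.
    by rewrite [in RHS]opprD [RHS]addrA addrK addrA.
  move=> r r0; rewrite nodeS => trT.
  have SrD x y : S r (x + y) = S r x + S r y.
    exact: (linearD (pack_linear (semigroup_linear hS r0))).
  rewrite SrD.
  rewrite big_ord_recr mulrDr (le_trans (nrmD _ _))// lerD//.
    rewrite -(semigroupD hS) ?(ltW taun0)//; apply: eB.
      by rewrite addr_ge0// ltW.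
    by rewrite (addrC r) addrA.
  have rT : 0 <= r <= T by rewrite r0 (le_trans _ trT)// lerDr.
  rewrite -mulrA (le_trans (MS r _ rT))// ler_wpM2l// nodeS.
  exact: quadE.
have main N tau U : grid T N tau -> method incl S c bw z g u0 N tau U ->
  forall n, (n <= N)%N -> exists2 e : X, incl e = u (node tau n) - U n &
    nrm e <=
      M * C0 * \sum_(j < n) tau j ^+ s.+1 * nrm_int h (node tau j) (node tau j.+1).
  move=> gT mU n nN; have [e eE eB] := stab N tau U gT mU n nN; exists e => //.
  have := eB 0; rewrite (semigroup0 hS) addr0; apply => //.
  exact: (node_leT gT nN).
split; last exact: main.
exists (M * C0 * nrm_int h 0 T) => N tau U taumax gT mU tm n nN.
have [e eE eB] := main N tau U gT mU n nN; exists e => //.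
apply: le_trans eB _; rewrite -[leRHS]mulrA ler_wpM2l ?mulr_ge0//.
(* [0 < T] rules out the empty grid, so taumax bounds a step and is nonnegative *)
have N0 : (0 < N)%N.
  by rewrite lt0n; apply/eqP => N0; move: hT; rewrite -gT.2 N0 node0 ltxx.
have tm0 : 0 <= taumax by rewrite (le_trans _ (tm 0%N N0))// ltW// gT.1.
apply: (@le_trans _ _ (nrm_int h 0 (node tau n) * taumax ^+ s.+1)); last first.
  rewrite ler_wpM2r ?exprn_ge0//; apply: (nrm_int_sub hI) => //.
  exact: (node_leT gT nN).
rewrite -(nrm_int_grid gT hI nN) mulr_suml; apply: ler_sum => j _.
have jN : (j < N)%N by exact: leq_trans (ltn_ord j) nN.
rewrite mulrC ler_wpM2l ?nrm_int_ge0// lerXn2r ?nnegrE ?tm//.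
exact/ltW/gT.1.
Qed.
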